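(* Let $R$ be an associative ring with identity such that the pure-injective envelope of every flat left $R$-module is flat, and let $\mathbf{K}^{\mathcal{F}}$ denote the class of flat left $R$-modules with pure embeddings. Let $\lambda$ be an infinite cardinal. (1) If $\lambda^{|R| + \aleph_0}=\lambda$, then $\mathbf{K}^{\mathcal{F}}$ is $\lambda$-stable. (2) If $\lambda^{|R| + \aleph_0}=\lambda$ or $\mu^{|R| + \aleph_0} < \lambda$ for every cardinal $\mu < \lambda$, then $\mathbf{K}^{\mathcal{F}}_\lambda$ has a universal model.
   Context: $\mathbf{K}^{\mathcal{F}} = (K_{flat}, \leq_{pp})$, where $K_{flat}$ is the class of flat left $R$-modules and $\leq_{pp}$ is the pure submodule relation; a pure embedding is an isomorphism onto a pure submodule; $\mathbf{K}^{\mathcal{F}}_{\lambda}$ is the class of flat left $R$-modules of cardinality $\lambda$. A universal model in $\mathbf{K}^{\mathcal{F}}_\lambda$ is a $U \in \mathbf{K}^{\mathcal{F}}_\lambda$ such that every $N \in \mathbf{K}^{\mathcal{F}}_\lambda$ admits a pure embedding into $U$. Galois-types in $\mathbf{K}^{\mathcal{F}}$: consider triples $(\bar b, A, N)$ with $N$ a flat left $R$-module, $A \subseteq N$ and $\bar b$ a sequence of elements of $N$. Set $(\bar b_1, A_1, N_1) E_{at} (\bar b_2, A_2, N_2)$ if $A_1 = A_2 =: A$ and there are a flat left $R$-module $N$ and pure embeddings $f_\ell : N_\ell \to N$ ($\ell = 1,2$) fixing $A$ pointwise such that $f_1(\bar b_1) = f_2(\bar b_2)$. Let $E$ be the transitive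 closure of $E_{at}$, and let $\mathbf{gtp}(\bar b/A; N)$ be the $E$-equivalence class of $(\bar b, A, N)$. For $M \in \mathbf{K}^{\mathcal{F}}$, $\mathbf{gS}(M) = \{\mathbf{gtp}(b/M;N) : M \leq_{pp} N \in \mathbf{K}^{\mathcal{F}},\ b \in N\}$ (types of single elements). $\mathbf{K}^{\mathcal{F}}$ is $\lambda$-stable if $|\mathbf{gS}(M)| \leq \lambda$ for every $M \in \mathbf{K}^{\mathcal{F}}_\lambda$. *)

(* Defs.v *)
From HB Require Import structures.
From mathcomp Require Import all_boot all_algebra.
From mathcomp Require Import all_classical.
From mathcomp.multinomials Require Import freeg.
From Stdlib Require Import Relations.Relation_Operators.

Set Implicit Arguments.
Unset Strict Implicit.
Unset Printing Implicit Defensive.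

Import GRing.Theory.

Local Open Scope classical_set_scope.
Local Open Scope card_scope.
Local Open Scope ring_scope.
Local Open Scope quotient_scope.

(* Left R-modules are [lmodType R]; right R-modules are [lmodType R^c], the
   right action a.r being [(r : R^c) *: a]. *)

Section Tensor.
Variables (R : nzRingType) (A : lmodType R^c) (M : lmodType R).

Inductive tensor_null : {freeg (A * M) / int} -> Prop :=
| TensorNull0 : tensor_null 0
| TensorNullB x y : tensor_null x -> tensor_null y -> tensor_null (x - y)
| TensorNullDl a a' m :
    tensor_null (<< (a + a', m) >> - << (a, m) >> - << (a', m) >>)
| TensorNullDr a m m' :
    tensor_null (<< (a, m + m') >> - << (a, m) >> - << (a, m') >>)
| TensorNullZ a (r : R) m :
    tensor_null (<< ((r : R^c) *: a, m) >> - << (a, r *: m) >>).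

Definition tensor_relation : {pred {freeg (A * M) / int}} :=
  fun x => `[< tensor_null x >].

Fact tensor_relation_zmod_closed : zmod_closed tensor_relation.
Proof.
split=> [|x y /asboolP x0 /asboolP y0]; apply/asboolP; first exact: TensorNull0.
exact: TensorNullB.
Qed.

HB.instance Definition _ := GRing.isZmodClosed.Build
  {freeg (A * M) / int} tensor_relation tensor_relation_zmod_closed.

Definition tensor : zmodType := Quotient.quot tensor_relation.

Definition tmul (a : A) (m : M) : tensor :=
  \pi_(Quotient.quot tensor_relation) << (a, m) >>.

End Tensor.

(* [tensor_map f] is the additive map with tmul a m |-> tmul (f a) m, computed
   on representatives. *)
Section TensorMap.
Variables (R : nzRingType) (A B : lmodType R^c) (M : lmodType R).
Variable (f : {linear A -> B}).

Definition freeg_map : {freeg (A * M) / int} -> {freeg (B * M) / int} :=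
  fglift (fun p : A * M => << (f p.1, p.2) >> : {freeg (B * M) / int}).

Fact freeg_map_null x : tensor_null x -> tensor_null (freeg_map x).
Proof.
have mapB := @lift_is_additive int _ _
  (fun p : A * M => << (f p.1, p.2) >> : {freeg (B * M) / int}).
have map0 : freeg_map 0 = 0 by rewrite -(subrr 0) /freeg_map mapB subrr.
have mapU p : freeg_map << p >> = << (f p.1, p.2) >>.
  by rewrite /freeg_map liftU scale1r.
elim=> [|u v _ fu _ fv|a a' m|a m m'|a r m].
- by rewrite map0; exact: TensorNull0.
- by rewrite /freeg_map mapB; exact: TensorNullB.
- rewrite /freeg_map !mapB -!/(freeg_map _) !mapU /= linearD.
  exact: TensorNullDl.
- by rewrite /freeg_map !mapB -!/(freeg_map _) !mapU /=; exact: TensorNullDr.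
- by rewrite /freeg_map !mapB -!/(freeg_map _) !mapU /= linearZ; exact: TensorNullZ.
Qed.

Definition tensor_map (t : tensor A M) : tensor B M :=
  \pi_(tensor B M) (freeg_map (repr t)).

Fact tensor_map_pi x :
  tensor_map (\pi_(tensor A M) x) = \pi_(tensor B M) (freeg_map x).
Proof.
apply/eqP; rewrite /tensor_map -Quotient.idealrBE.
apply/asboolP; rewrite -(@lift_is_additive int); apply: freeg_map_null.
apply/asboolP; rewrite -[asbool _]/(_ \in @tensor_relation _ A M).
by rewrite Quotient.idealrBE reprK.
Qed.

Fact tensor_map_zmod_morphism : zmod_morphism tensor_map.
Proof.
move=> t u; rewrite -(reprK t) -(reprK u) -raddfB !tensor_map_pi -raddfB.
by rewrite /freeg_map lift_is_additive.
Qed.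

HB.instance Definition _ := GRing.isZmodMorphism.Build (tensor A M) (tensor B M)
  tensor_map tensor_map_zmod_morphism.

Fact tensor_map_tmul a m : tensor_map (tmul a m) = tmul (f a) m.
Proof. by rewrite tensor_map_pi /freeg_map liftU scale1r. Qed.

End TensorMap.

Definition flat (R : nzRingType) (M : lmodType R) : Prop :=
  forall (A B : lmodType R^c) (f : {linear A -> B}),
    injective f -> injective (tensor_map (M := M) f).

Section Purity.
Variable R : nzRingType.

(* The submodule P satisfies at x the positive primitive formula
   "exists y, A y = B x". *)
Definition pp_sat (N : lmodType R) (P : set N) (m n k : nat)
    (A : 'M[R]_(m, k)) (B : 'M[R]_(m, n)) (x : 'I_n -> N) : Prop :=
  exists2 y : 'I_k -> N, forall j, P (y j) &
    forall i, \sum_j A i j *: y j = \sum_j B i j *: x j.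

Definition submodule (N : lmodType R) (P : set N) : Prop :=
  submod_closed (mem P).

Definition pure_submodule (N : lmodType R) (P : set N) : Prop :=
  submodule P /\
  forall (m n k : nat) (A : 'M[R]_(m, k)) (B : 'M[R]_(m, n)) (x : 'I_n -> N),
    (forall j, P (x j)) -> pp_sat setT A B x -> pp_sat P A B x.

Definition pure_embedding (M N : lmodType R) (f : {linear M -> N}) : Prop :=
  injective f /\ pure_submodule (range f).

Definition pure_injective (E : lmodType R) : Prop :=
  forall (M N : lmodType R) (i : {linear M -> N}) (g : {linear M -> E}),
    pure_embedding i -> exists h : {linear N -> E}, h \o i =1 g.

(* Minimality: a pure-injective pure submodule of E that contains the image of
   M (and in which M is therefore pure) is all of E. *)
Definition pure_injective_envelope (M E : lmodType R) (i : {linear M -> E}) :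
    Prop :=
  [/\ pure_injective E, pure_embedding i &
    forall (E' : lmodType R) (i' : {linear M -> E'}) (j : {linear E' -> E}),
      pure_injective E' -> pure_embedding i' -> pure_embedding j ->
      j \o i' =1 i -> range j = setT].

End Purity.

(* A cardinal is represented by a type of that cardinality. *)
Definition cardinal := Type.

Definition card_lt (T U : cardinal) : Prop :=
  ([set: T] #<= [set: U]) && ~~ ([set: U] #<= [set: T]).

Section GaloisTypes.
Variable R : nzRingType.

(* Triples (b, A, N). The set A is a type together with an injection into N,
   so that several modules can share the same A; b is indexed by I. *)
Record gtriple (I A : Type) := GTriple {
  gt_model : lmodType R;
  gt_flat : flat gt_model;
  gt_base : A -> gt_model;
  gt_base_inj : injective gt_base;
  gt_seq : I -> gt_model }.

Definition E_at (I A : Type) (t1 t2 : gtriple I A) : Prop :=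
  exists (N : lmodType R) (f1 : {linear gt_model t1 -> N})
      (f2 : {linear gt_model t2 -> N}),
    [/\ flat N, pure_embedding f1, pure_embedding f2,
        f1 \o gt_base t1 =1 f2 \o gt_base t2 &
        f1 \o gt_seq t1 =1 f2 \o gt_seq t2].

Definition gtp (I A : Type) (t : gtriple I A) : gtriple I A -> Prop :=
  clos_trans _ (@E_at I A) t.

(* Types over M are equivalence classes of triples whose base is M purely
   embedded. Triples quantify over all modules, so classes of triples lie one
   universe above [set]: [stable] bounds |gS M| by an explicit injection
   because [card_le] does not apply. *)
Definition gS (M : lmodType R) : Type :=
  {p : gtriple unit M -> Prop | exists t : gtriple unit M,
    (exists2 i : {linear M -> gt_model t}, pure_embedding i & gt_base t =1 i) /\
    p = gtp t}.

Definition has_card (M : lmodType R) (lam : cardinal) : Prop :=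
  [set: M] #= [set: lam].

Definition stable (lam : cardinal) : Prop :=
  forall M : lmodType R, flat M -> has_card M lam ->
    exists c : gS M -> lam, injective c.

Definition universal_model (lam : cardinal) (U : lmodType R) : Prop :=
  [/\ flat U, has_card U lam &
    forall N : lmodType R, flat N -> has_card N lam ->
      exists f : {linear N -> U}, pure_embedding f].

End GaloisTypes.

(* Main.v *)
Require Import Defs.
From HB Require Import structures.
From mathcomp Require Import all_boot all_order all_algebra.
From mathcomp Require Import all_classical.
From mathcomp Require wochoice.
From mathcomp.multinomials Require Import freeg.
From Stdlib Require Import Relations.Relation_Operators.

(** The solubility in a module of a system of linear equations [A y = v], with
    the matrix over the ring and the right-hand side in the module, is all that
    has to be known about positive primitive formulas: pure embeddings are the
    homomorphisms that reflect it, a pure-injective module is one into which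
    partial homomorphisms that preserve it extend, and a type of an element
    over a pure submodule turns out to be the list of the systems that become
    soluble in it.

    Flatness is first rewritten as the equational criterion
    ([flat_eqflat], [eqflat_flat]), from the vanishing criterion for sums of
    pure tensors; after that pure submodules, pure quotients and direct sums of
    flat modules are flat for elementary reasons. Every module is pure in its
    double character module, which is pure-injective, and inside a
    pure-injective module each submodule has a hull ([hull_exists]): a direct
    summand on which every homomorphism respecting systems over the submodule
    respects all systems. Hence pure-injective envelopes exist, and the
    assumption on the ring puts each flat module in a flat pure-injective one.

    For stability, let an element of [N1] and one of [N2] satisfy the same
    systems over [M]. In a flat pure-injective extension of [N1] the hull of
    the common part is a direct summand; it is mapped to an extension of [N2],
    and the complementary summand is kept, which gives a flat amalgam
    ([flat_amalgamation]). So a Galois type is determined by its systems. The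
    right-hand sides in [M] that make a given system soluble form a coset of a
    subgroup depending only on [M], so that choosing one of them for each of
    the [|R| + aleph_0] systems determines the type ([gS_emb]).

    For the universal model, a flat pure-injective module [G] with at most
    [2 ^ (|R| + aleph_0)] elements contains all flat modules with at most
    [|R| + aleph_0] elements ([small_flat_container]). A direct sum of copies of
    [G], indexed by a well-ordering of [lam] with initial segments smaller than
    [lam], is pure in a flat pure-injective module [W]. For each segment, the
    copies indexed by it are closed under solutions of sets of at most
    [|R| + aleph_0] conditions; this gives a direct summand of [W], and by the
    assumption on [lam] it has at most [lam] elements. The union of these
    summands is the universal model. A flat module [N] with [lam] elements is
    embedded by adding to a pure submodule, again and again, a small flat
    quotient: the partial embedding extends to a homomorphism because the
    summand is pure-injective, and it becomes pure again once the quotient is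
    embedded in a copy of [G] that has not been used
    ([partial_embedding_step]). *)

Set Implicit Arguments.
Unset Strict Implicit.
Unset Printing Implicit Defensive.

Import GRing.Theory.

Local Open Scope classical_set_scope.
Local Open Scope card_scope.
Local Open Scope ring_scope.

(** * Submodules, quotients and products *)

Lemma submoduleP (R : nzRingType) (N : lmodType R) (P : set N) :
  submodule P <-> P 0 /\ forall a u v, P u -> P v -> P (a *: u + v).
Proof.
by split=> -[P0 PD]; split=> //; first exact: set_mem P0;
  [move=> a u v Pu Pv; apply/set_mem/PD; exact: mem_set
  |exact: mem_set
  |move=> a u v /set_mem Pu /set_mem Pv; exact/mem_set/PD].
Qed.

Section SubmoduleTheory.
Variables (R : nzRingType) (N : lmodType R) (P : set N).
Hypothesis subP : submodule P.

Lemma submodule0 : P 0. Proof. exact: ((submoduleP P).1 subP).1. Qed.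

Lemma submoduleD u v : P u -> P v -> P (u + v).
Proof. by move=> Pu Pv; rewrite -[u]scale1r; apply: ((submoduleP P).1 subP).2. Qed.

Lemma submoduleZ a u : P u -> P (a *: u).
Proof.
by move=> Pu; rewrite -[_ *: _]addr0; apply: ((submoduleP P).1 subP).2 => //;
  exact: submodule0.
Qed.

Lemma submoduleN u : P u -> P (- u).
Proof. by rewrite -scaleN1r; apply: submoduleZ. Qed.

Lemma submoduleB u v : P u -> P v -> P (u - v).
Proof. by move=> Pu Pv; apply/submoduleD/submoduleN. Qed.

Lemma submodule_sum I (r : seq I) (F : I -> N) :
  (forall i, P (F i)) -> P (\sum_(i <- r) F i).
Proof.
by move=> PF; apply: (big_ind P) => //; [exact: submodule0|exact: submoduleD].
Qed.

Lemma submodule_comb I (r : seq I) (a : I -> R) (F : I -> N) :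
  (forall i, P (F i)) -> P (\sum_(i <- r) a i *: F i).
Proof. by move=> PF; apply: submodule_sum => i; apply: submoduleZ. Qed.

End SubmoduleTheory.

Lemma submoduleT (R : nzRingType) (N : lmodType R) : submodule [set: N].
Proof. exact/submoduleP. Qed.

Lemma submodule_image (R : nzRingType) (M N : lmodType R) (f : {linear M -> N})
  (P : set M) : submodule P -> submodule (f @` P).
Proof.
move=> sP; apply/submoduleP; split; first by exists 0; [exact: submodule0|rewrite linear0].
move=> a _ _ [u Pu <-] [v Pv <-]; exists (a *: u + v); last by rewrite linearP.
by apply: submoduleD => //; apply: submoduleZ.
Qed.

Lemma submodule_range (R : nzRingType) (M N : lmodType R) (f : {linear M -> N}) :
  submodule (range f).
Proof. exact/submodule_image/submoduleT. Qed.

Section SubmoduleModule.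
Variables (R : nzRingType) (N : lmodType R) (P : set N) (subP : submodule P).

Definition submod_pred of submodule P : {pred N} := fun x => `[< P x >].
Local Notation pP := (submod_pred subP).

Fact submod_pred_closed : submod_closed pP.
Proof.
split=> [|a u v /asboolP Pu /asboolP Pv]; apply/asboolP.
  exact: submodule0.
by apply: submoduleD => //; apply: submoduleZ.
Qed.

HB.instance Definition _ := GRing.isSubmodClosed.Build R N pP submod_pred_closed.

Record submod := Submod { submod_val : N; _ : submod_val \in pP }.
HB.instance Definition _ := [isSub for submod_val].
HB.instance Definition _ := [Choice of submod by <:].
HB.instance Definition _ := [SubChoice_isSubLmodule of submod by <:].

Lemma submod_exists :
  exists (K : lmodType R) (i : {linear K -> N}), injective i /\ range i = P.
Proof.
exists submod, (\val : {linear submod -> N}); split; first exact: val_inj.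
apply/seteqP; split=> [_ [x _ <-]|x Px]; first exact/asboolP/(valP x).
by exists (Submod (asboolT Px)).
Qed.

End SubmoduleModule.

Section QuotientModule.
Variables (R : nzRingType) (N : lmodType R) (P : set N) (subP : submodule P).

Definition quotmod : Type := Quotient.quot (submod_pred subP).
HB.instance Definition _ := GRing.Zmodule.on quotmod.

Definition quot_proj (x : N) : quotmod := \pi_(Quotient.quot (submod_pred subP))%qT x.

Lemma quot_projB : zmod_morphism quot_proj.
Proof. by move=> x y; rewrite /quot_proj -raddfB. Qed.

Lemma quot_proj_eq x y : quot_proj x = quot_proj y <-> P (x - y).
Proof.
split=> [/eqP|Pxy]; first by rewrite /quot_proj -Quotient.idealrBE => /asboolP.
by apply/eqP; rewrite /quot_proj -Quotient.idealrBE; apply/asboolP.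
Qed.

Lemma quot_proj_surj q : exists x, quot_proj x = q.
Proof. by exists (repr q); rewrite /quot_proj reprK. Qed.

Definition quot_scale (a : R) (q : quotmod) : quotmod := quot_proj (a *: repr q).

Lemma quot_scaleE a x : quot_scale a (quot_proj x) = quot_proj (a *: x).
Proof.
apply/quot_proj_eq; rewrite -scalerBr; apply: submoduleZ => //.
by apply/quot_proj_eq; rewrite /quot_proj reprK.
Qed.

Fact quot_scaleA a b q : quot_scale a (quot_scale b q) = quot_scale (a * b) q.
Proof. by have [x <-] := quot_proj_surj q; rewrite !quot_scaleE scalerA. Qed.
Fact quot_scale1 q : quot_scale 1 q = q.
Proof. by have [x <-] := quot_proj_surj q; rewrite !quot_scaleE scale1r. Qed.
Fact quot_projD x y : quot_proj (x + y) = quot_proj x + quot_proj y.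
Proof.
have proj0 : quot_proj 0 = 0 by rewrite -(subrr 0) quot_projB subrr.
by rewrite -{1}(opprK y) quot_projB -(sub0r y) quot_projB proj0 sub0r opprK.
Qed.
Fact quot_scaleDr a : {morph quot_scale a : p q / p + q}.
Proof.
move=> p q; have [x <-] := quot_proj_surj p; have [y <-] := quot_proj_surj q.
by rewrite -quot_projD !quot_scaleE scalerDr quot_projD.
Qed.
Fact quot_scaleDl q : {morph quot_scale^~ q : a b / a + b}.
Proof.
move=> a b; have [x <-] := quot_proj_surj q.
by rewrite !quot_scaleE scalerDl quot_projD.
Qed.

HB.instance Definition _ := GRing.Zmodule_isLmodule.Build R quotmod
  quot_scaleA quot_scale1 quot_scaleDr quot_scaleDl.

Fact quot_proj_scalable : scalable quot_proj.
Proof. by move=> a x; rewrite -quot_scaleE. Qed.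

HB.instance Definition _ := GRing.isZmodMorphism.Build N quotmod quot_proj quot_projB.
HB.instance Definition _ := GRing.isScalable.Build R N quotmod _ quot_proj
  quot_proj_scalable.

Lemma quot_proj_eq0 x : quot_proj x = 0 <-> P x.
Proof. by rewrite -(linear0 quot_proj) quot_proj_eq subr0. Qed.

End QuotientModule.

Section DependentProduct.
Variables (R : nzRingType) (I : Type) (H : I -> lmodType R).

Definition dprod := forall i, H i.
HB.instance Definition _ := gen_eqMixin dprod.
HB.instance Definition _ := gen_choiceMixin dprod.

Implicit Types u v w : dprod.
Definition dprod_add u v : dprod := fun i => u i + v i.
Definition dprod_opp u : dprod := fun i => - u i.
Definition dprod_zero : dprod := fun=> 0.
Definition dprod_scale a u : dprod := fun i => a *: u i.

Fact dprod_addA : associative dprod_add.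
Proof. by move=> u v w; apply: functional_extensionality_dep => i; exact: addrA. Qed.
Fact dprod_addC : commutative dprod_add.
Proof. by move=> u v; apply: functional_extensionality_dep => i; exact: addrC. Qed.
Fact dprod_add0 : left_id dprod_zero dprod_add.
Proof. by move=> u; apply: functional_extensionality_dep => i; exact: add0r. Qed.
Fact dprod_addN : left_inverse dprod_zero dprod_opp dprod_add.
Proof. by move=> u; apply: functional_extensionality_dep => i; exact: addNr. Qed.

HB.instance Definition _ := GRing.isZmodule.Build dprod
  dprod_addA dprod_addC dprod_add0 dprod_addN.

Fact dprod_scaleA a b u : dprod_scale a (dprod_scale b u) = dprod_scale (a * b) u.
Proof. by apply: functional_extensionality_dep => i; exact: scalerA. Qed.
Fact dprod_scale1 u : dprod_scale 1 u = u.
Proof. by apply: functional_extensionality_dep => i; exact: scale1r. Qed.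
Fact dprod_scaleDr a : {morph dprod_scale a : u v / u + v}.
Proof. by move=> u v; apply: functional_extensionality_dep => i; exact: scalerDr. Qed.
Fact dprod_scaleDl u : {morph dprod_scale^~ u : a b / a + b}.
Proof. by move=> a b; apply: functional_extensionality_dep => i; exact: scalerDl. Qed.

HB.instance Definition _ := GRing.Zmodule_isLmodule.Build R dprod
  dprod_scaleA dprod_scale1 dprod_scaleDr dprod_scaleDl.

End DependentProduct.

Definition linear_pack (R : nzRingType) (X Y : lmodType R) (f : X -> Y)
    (lin_f : linear f) : {linear X -> Y} :=
  HB.pack f (GRing.isLinear.Build R X Y _ f lin_f).

(** Partial homomorphisms are handled as graphs, which are submodules of a
    product and to which Zorn's lemma applies; a total graph is turned into a
    homomorphism here. *)
Lemma linear_of_graph (R : nzRingType) (X Y : lmodType R) (G : set (X * Y)) :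
    submodule G -> (forall y, G (0, y) -> y = 0) -> (forall x, exists y, G (x, y)) ->
  exists f : {linear X -> Y}, forall x, G (x, f x).
Proof.
move=> sG G0 /choice[f Gf].
have Glin : linear f.
  move=> a x y; apply/eqP; rewrite -subr_eq0; apply/eqP/G0.
  have -> : (0, f (a *: x + y) - (a *: f x + f y)) =
    (a *: x + y, f (a *: x + y)) - (a *: (x, f x) + (y, f y)) :> X * Y.
    by congr pair; rewrite /= ?subrr.
  apply: submoduleB => //; apply: submoduleD => //; exact: submoduleZ.
by exists (linear_pack Glin).
Qed.

(** * Solvability of linear systems, and purity *)

Section Soluble.
Variable R : nzRingType.

Definition soluble_in (X : lmodType R) (P : set X) m k (A : 'M[R]_(m, k))
    (v : 'I_m -> X) : Prop :=
  exists2 y : 'I_k -> X, forall j, P (y j) & forall i, \sum_j A i j *: y j = v i.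

(** A positive primitive condition on a tuple from a submodule is the solubility
    of such a system with right-hand side in the submodule: the matrix applied
    to the tuple is absorbed in [v]. *)
Definition soluble (X : lmodType R) m k (A : 'M[R]_(m, k)) (v : 'I_m -> X) : Prop :=
  exists y : 'I_k -> X, forall i, \sum_j A i j *: y j = v i.

Lemma soluble_ext (X : lmodType R) m k (A : 'M[R]_(m, k)) (v w : 'I_m -> X) :
  v =1 w -> soluble A v -> soluble A w.
Proof. by move=> vw [y yv]; exists y => i; rewrite yv. Qed.

Lemma soluble_map (X Y : lmodType R) (f : {linear X -> Y}) m k (A : 'M[R]_(m, k)) v :
  soluble A v -> soluble A (fun i => f (v i)).
Proof.
move=> [y yv]; exists (f \o y) => i; rewrite -yv linear_sum.
by apply: eq_bigr => j _; rewrite linearZ.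
Qed.

Lemma solubleD (X : lmodType R) m k (A : 'M[R]_(m, k)) (v w : 'I_m -> X) :
  soluble A v -> soluble A w -> soluble A (fun i => v i + w i).
Proof.
move=> [y yv] [z zw]; exists (fun j => y j + z j) => i; rewrite -yv -zw -big_split.
by apply: eq_bigr => j _; rewrite scalerDr.
Qed.

Lemma solubleB (X : lmodType R) m k (A : 'M[R]_(m, k)) (v w : 'I_m -> X) :
  soluble A v -> soluble A w -> soluble A (fun i => v i - w i).
Proof.
move=> [y yv] [z zw]; exists (fun j => y j - z j) => i; rewrite -yv -zw -sumrB.
by apply: eq_bigr => j _; rewrite scalerBr.
Qed.

Lemma soluble_comb (X : lmodType R) m k (A : 'M[R]_(m, k)) (y : 'I_k -> X) :
  soluble A (fun i => \sum_j A i j *: y j).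
Proof. by exists y. Qed.

(** Equality is thus a condition of the same kind as all the others, and a
    homomorphism that reflects solubility is injective. *)
Lemma soluble0 (X : lmodType R) (x : X) :
  soluble (0 : 'M[R]_(1, 0)) (fun=> x) <-> x = 0.
Proof.
split=> [[y /(_ ord0)]|->]; first by rewrite big_ord0.
by exists (fun=> 0) => i; rewrite big_ord0.
Qed.

(** For a submodule [C] this says that tuples of [C] have the same positive
    primitive type in [X] as their images in [Y]. *)
Definition reflecting (X Y : lmodType R) (f : {linear X -> Y}) (C : set X) : Prop :=
  forall m k (A : 'M[R]_(m, k)) v,
    (forall i, C (v i)) -> soluble A (fun i => f (v i)) -> soluble A v.

Lemma reflecting_inj (X Y : lmodType R) (f : {linear X -> Y}) (C : set X) x :
  reflecting f C -> C x -> f x = 0 -> x = 0.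
Proof.
move=> fC Cx fx0; apply/soluble0; apply: fC => // ; exact/soluble0.
Qed.

Lemma pure_embeddingP (X Y : lmodType R) (f : {linear X -> Y}) :
  pure_embedding f <-> reflecting f setT.
Proof.
split=> [[injf [_ puref]] m k A v _ [y yv]|ref].
  have [j||z zf zv] := puref m m k A 1%:M (fun i => f (v i)).
  - by exists (v j).
  - exists y => // i; rewrite yv (bigD1 i) //= mxE eqxx scale1r big1 ?addr0 // => j ji.
    by rewrite mxE eq_sym (negPf ji) scale0r.
  have /choice[z' z'z] : forall j, exists t, f t = z j.
    by move=> j; have [t _ <-] := zf j; exists t.
  exists z' => i; apply: injf.
  rewrite linear_sum (eq_bigr (fun j => A i j *: z j)) => [|j _]; last first.
    by rewrite linearZ /= z'z.
  rewrite zv (bigD1 i) //= mxE eqxx scale1r big1 ?addr0 // => j ji.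
  by rewrite mxE eq_sym (negPf ji) scale0r.
split; last (split; first exact: submodule_range).
  apply: raddf_inj => x fx0; exact: reflecting_inj ref _ _.
move=> m n k A B x xr [y _ yx].
have /choice[x' x'x] : forall j, exists t, f t = x j.
  by move=> j; have [t _ <-] := xr j; exists t.
have [||z zx] := ref m k A (fun i => \sum_j B i j *: x' j) => //.
  exists y => i; rewrite yx linear_sum.
  by apply: eq_bigr => j _; rewrite linearZ /= x'x.
exists (f \o z) => [j|i]; first by exists (z j).
rewrite -[LHS](_ : f (\sum_j A i j *: z j) = _); last first.
  by rewrite linear_sum; apply: eq_bigr => j _; rewrite linearZ.
rewrite zx linear_sum; apply: eq_bigr => j _.
by rewrite linearZ /= x'x.
Qed.

Lemma pure_embedding_reflects (X Y : lmodType R) (f : {linear X -> Y}) m k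
  (A : 'M[R]_(m, k)) v :
  pure_embedding f -> soluble A (fun i => f (v i)) -> soluble A v.
Proof. by move=> /pure_embeddingP; apply. Qed.

Definition pure_in (N : lmodType R) (P : set N) : Prop :=
  forall m k (A : 'M[R]_(m, k)) v,
    (forall i, P (v i)) -> soluble A v -> soluble_in P A v.

Lemma pure_in_embedding (K N : lmodType R) (i : {linear K -> N}) :
  injective i -> pure_in (range i) -> pure_embedding i.
Proof.
move=> inji purei; apply/pure_embeddingP => m k A v _ /purei[j|y yr yv].
  by exists (v j).
have /choice[z' z'y] : forall j, exists t, i t = y j.
  by move=> j; have [t _ <-] := yr j; exists t.
exists z' => l; apply: inji; rewrite linear_sum -yv.
by apply: eq_bigr => j _; rewrite linearZ /= z'y.
Qed.

Lemma pure_embedding_comp (X Y Z : lmodType R) (f : {linear X -> Y})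
  (g : {linear Y -> Z}) :
  pure_embedding f -> pure_embedding g -> pure_embedding (g \o f).
Proof.
move=> pf pg; apply/pure_embeddingP => m k A v _ /(pure_embedding_reflects pg).
exact: pure_embedding_reflects.
Qed.

End Soluble.

(** * Flatness by equations *)

Lemma zmod_morphism_sum (U V : zmodType) (f : U -> V) I (r : seq I) (F : I -> U) :
  zmod_morphism f -> f (\sum_(i <- r) F i) = \sum_(i <- r) f (F i).
Proof.
move=> fB; pose g : {additive U -> V} := HB.pack f (GRing.isZmodMorphism.Build U V f fB).
exact: (raddf_sum g).
Qed.

Section TensorVanishing.
Variables (R : nzRingType) (A : lmodType R^c) (M : lmodType R).
Local Open Scope quotient_scope.

Lemma tensor_pi_eq0 (x : {freeg (A * M) / int}) :
  \pi_(tensor A M) x = 0 <-> tensor_null x.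
Proof.
rewrite -(raddf0 \pi_(tensor A M)); split=> [/eqP|x0].
  by rewrite -Quotient.idealrBE subr0 => /asboolP.
by apply/eqP; rewrite -Quotient.idealrBE subr0; apply/asboolP.
Qed.

Lemma tmulDl a a' m : tmul (a + a') m = tmul a m + tmul a' m :> tensor A M.
Proof.
apply/eqP; rewrite -subr_eq0 opprD addrA -!raddfB; apply/eqP/tensor_pi_eq0.
exact: TensorNullDl.
Qed.

Lemma tmulDr a m m' : tmul a (m + m') = tmul a m + tmul a m' :> tensor A M.
Proof.
apply/eqP; rewrite -subr_eq0 opprD addrA -!raddfB; apply/eqP/tensor_pi_eq0.
exact: TensorNullDr.
Qed.

Lemma tmulZ a (r : R) m : tmul ((r : R^c) *: a) m = tmul a (r *: m) :> tensor A M.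
Proof.
apply/eqP; rewrite -subr_eq0 -!raddfB; apply/eqP/tensor_pi_eq0; exact: TensorNullZ.
Qed.

Lemma tmul_zmod_r a : zmod_morphism (@tmul R A M a).
Proof.
move=> m m'; apply/eqP; rewrite eq_sym subr_eq -tmulDr.
by rewrite subrK.
Qed.

Lemma tmul_zmod_l m : zmod_morphism (@tmul R A M ^~ m).
Proof.
move=> a a'; apply/eqP; rewrite eq_sym subr_eq -tmulDl.
by rewrite subrK.
Qed.

HB.instance Definition _ a := GRing.isZmodMorphism.Build M (tensor A M) (tmul a) (tmul_zmod_r a).

Lemma tmul0l m : tmul 0 m = 0 :> tensor A M.
Proof. by have := tmul_zmod_l m 0 0; rewrite !subrr. Qed.

Lemma tmul_suml I (r : seq I) (F : I -> A) m :
  tmul (\sum_(i <- r) F i) m = \sum_(i <- r) tmul (F i) m :> tensor A M.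
Proof.
by elim: r => [|i r IH]; rewrite ?big_nil ?tmul0l // !big_cons tmulDl IH.
Qed.

Lemma tensor_sum (t : tensor A M) :
  exists n (a : 'I_n -> A) (m : 'I_n -> M), t = \sum_i tmul (a i) (m i).
Proof.
suff [s ->] : exists s : seq (A * M), t = \sum_(p <- s) tmul p.1 p.2.
  exists (size s), (fun i => (tnth (in_tuple s) i).1), (fun i => (tnth (in_tuple s) i).2).
  by rewrite big_tnth.
have -> : t = \sum_(p <- dom (repr t)) \pi << coeff p (repr t) *g p >>.
  by rewrite -[LHS]reprK -{1}(freeg_sumE (repr t)) raddf_sum.
exists [seq (p.1, p.2 *~ coeff p (repr t)) | p <- dom (repr t)].
rewrite [RHS]big_map; apply: eq_bigr => -[a m] _ /=.
by rewrite raddfMz /= /tmul -[RHS]raddfMz freegU_mulz intz.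
Qed.

(** Bourbaki's criterion for a sum of pure tensors to vanish. The sums in
    which it holds form a subgroup, and it is enough to see that this subgroup
    contains the defining relations of the tensor product; for this an element
    of the tensor product is read as a family of elements of [M] indexed by
    generators of [A], modulo the products of a relation between generators by
    an element of [M]. The given [a i] are kept apart from the other elements
    of [A], as they may coincide. *)
Lemma tensor_vanishing n (a : 'I_n -> A) (m : 'I_n -> M) :
    \sum_i tmul (a i) (m i) = 0 :> tensor A M ->
  exists p k (b : 'I_p -> A) (C : 'M[R]_(n, k)) (C' : 'M[R]_(p, k)) (y : 'I_k -> M),
    [/\ forall i, m i = \sum_j C i j *: y j,
        forall q, \sum_j C' q j *: y j = 0 &
        forall j, \sum_i (C i j : R^c) *: a i + \sum_q (C' q j : R^c) *: b q = 0].
Proof.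
pose I : choiceType := ('I_n + A)%type.
pose V := {freeg I / R^c}.
pose gen (i : I) : A := match i with inl l => a l | inr x => x end.
pose ev : V -> A := fglift gen.
have evB : zmod_morphism ev by exact: lift_is_additive.
have evU (c : R) i : ev << (c : R^c) *g i >> = (c : R^c) *: gen i by exact: liftU.
pose u (i : I) : V := << i >>.
pose phi (v : V) (x : M) : I -> M := fun i => (coeff i v : R) *: x.
pose L (g : I -> M) := exists s : seq (V * M), (forall p, p \in s -> ev p.1 = 0) /\
  g = \sum_(p <- s) phi p.1 p.2.
have phiB v w x : phi (v - w) x = phi v x - phi w x.
  by apply: functional_extensionality_dep => i; rewrite /phi coeffB scalerBl.
have phiDr v x y : phi v (x + y) = phi v x + phi v y.
  by apply: functional_extensionality_dep => i; rewrite /phi scalerDr.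
have phiNr v x : phi v (- x) = - phi v x.
  by apply: functional_extensionality_dep => i; rewrite /phi scalerN.
have L0 : L 0 by exists [::]; rewrite big_nil.
have LB g h : L g -> L h -> L (g - h).
  move=> [s [s0 ->]] [t [t0 ->]]; exists (s ++ [seq (p.1, - p.2) | p <- t]); split.
    by move=> p; rewrite mem_cat => /orP[/s0 //|/mapP[q /t0 q0 ->]].
  rewrite big_cat big_map -sumrN; congr (_ + _).
  by apply: eq_bigr => p _; rewrite phiNr.
have LD g h : L g -> L h -> L (g + h).
  by move=> Lg Lh; rewrite -[h]opprK -[- h]sub0r; exact: (LB _ _ Lg (LB _ _ L0 Lh)).
have Lphi v x : ev v = 0 -> L (phi v x).
  by move=> v0; exists [:: (v, x)]; rewrite big_seq1; split=> // p; rewrite inE => /eqP ->.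
pose psi : {freeg (A * M) / int} -> zmodule (I -> M) :=
  fglift (fun p : A * M => phi (u (inr p.1)) p.2 : zmodule (I -> M)).
have psiB : zmod_morphism psi by exact: lift_is_additive.
have psiU p : psi << p >> = phi (u (inr p.1)) p.2 by rewrite /psi liftU scale1r.
have psi0 : psi 0 = 0 by rewrite -(subrr 0) psiB subrr.
have Lpsi x : tensor_null x -> L (psi x).
  elim=> [|z1 z2 _ L1 _ L2|x1 x2 x3|x1 x2 x3|x1 r x2]; rewrite ?psi0 ?psiB ?psiU //=.
  - exact: LB.
  - rewrite -!phiB; apply: Lphi; rewrite !evB /u !evU !scale1r /=.
    by rewrite addrAC addrK subrr.
  - rewrite phiDr addrAC addrK subrr //.
  - have -> : phi (u (inr x1)) (r *: x2) = phi << (r : R^c) *g (inr x1 : I) >> x2.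
      apply: functional_extensionality_dep => i; rewrite /phi /u !coeffU scalerA mul1r.
      by congr (_ *: _); case: (_ == _); rewrite ?mulr1n ?mulr0n ?mul1r ?mul0r ?mulr1 ?mulr0.
    by rewrite -!phiB; apply: Lphi; rewrite evB /u !evU scale1r subrr.
move=> sum0.
have {}sum0 : tensor_null (\sum_i << (a i, m i) >>).
  by apply/tensor_pi_eq0; rewrite raddf_sum.
have [s [s0 sE]] : L (\sum_i phi (u (inl i)) (m i)).
  have -> : \sum_i phi (u (inl i)) (m i) =
      psi (\sum_i << (a i, m i) >>) + \sum_i phi ((u (inl i)) - (u (inr (a i)))) (m i).
    have -> : psi (\sum_i << (a i, m i) >>) = \sum_i phi (u (inr (a i))) (m i).
      by rewrite zmod_morphism_sum //; apply: eq_bigr => i _; exact: psiU.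
    by rewrite -big_split; apply: eq_bigr => i _; rewrite phiB [RHS]addrC subrK.
  apply: (LD); first exact: Lpsi.
  apply: (big_ind L L0 LD) => i _; apply: Lphi.
  by rewrite evB /u !evU !scale1r subrr.
(* Only finitely many elements of A occur in the relations listed in s. *)
pose bs := undup (pmap (fun i : I => if i is inr x then Some x else None)
  (flatten [seq dom p.1 | p <- s])).
pose all_gen : seq I := map inl (enum 'I_n) ++ map inr bs.
have all_uniq : uniq all_gen.
  have inlI : injective (inl : 'I_n -> I) by move=> x y [].
  have inrI : injective (inr : A -> I) by move=> x y [].
  rewrite cat_uniq (map_inj_uniq inlI) (map_inj_uniq inrI) enum_uniq undup_uniq andbT /=.
  by apply/negP => /hasP[_ /mapP[x _ ->] /mapP[]].
have all_dom p : p \in s -> {subset dom p.1 <= all_gen}.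
  move=> ps [l|x] lx; rewrite mem_cat; first by rewrite map_f ?mem_enum.
  apply/orP; right; apply: map_f; rewrite mem_undup mem_pmap.
  apply/mapP; exists (inr x) => //; apply/flattenP; exists (dom p.1) => //.
  exact: (map_f (fun p : V * M => dom p.1)).
have evE v : {subset dom v <= all_gen} ->
    ev v = \sum_i (coeff (inl i) v : R^c) *: a i
           + \sum_(q < size bs) (coeff (inr (tnth (in_tuple bs) q)) v : R^c) *: tnth (in_tuple bs) q.
  move=> vdom; rewrite -(big_tnth _ _ bs predT (fun x => (coeff (inr x) v : R^c) *: x)).
  have -> : ev v = \sum_(i <- dom v) (coeff i v) *: gen i.
    rewrite -{1}(freeg_sumE v) zmod_morphism_sum //.
    by apply: eq_bigr => i _; exact: evU.
  rewrite -[X in X + _]big_enum /= -(big_map (fun i => inl i : I) predT (fun i => coeff i v *: gen i)).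
  rewrite -[X in _ + X](big_map (fun i => inr i : I) predT (fun i => coeff i v *: gen i)).
  rewrite -big_cat -/all_gen [RHS](bigID (mem (dom v))) /= [X in _ = _ + X]big1 ?addr0.
    rewrite -[RHS]big_filter; apply: perm_big; apply: uniq_perm.
    - exact: uniq_dom.
    - exact: filter_uniq.
    - move=> i; rewrite mem_filter; apply/idP/andP => [iv|[] //]; split=> //; exact: vdom.
  by move=> i iv; rewrite coeff_outdom // scale0r.
have val i : (\sum_i phi (u (inl i)) (m i)) i =
   \sum_(j < size s) (coeff i (tnth (in_tuple s) j).1 : R) *: (tnth (in_tuple s) j).2.
  rewrite sE -(big_tnth _ _ s predT (fun p => (coeff i p.1 : R) *: p.2)).
  by elim: (s) => [|p t IH]; rewrite ?big_nil // !big_cons -IH.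
have vall i : (\sum_i phi (u (inl i)) (m i)) i = if i is inl l then m l else 0.
  have -> : (\sum_i phi (u (inl i)) (m i)) i = \sum_l phi (u (inl l)) (m l) i.
    by elim: (index_enum _) => [|p t IH]; rewrite ?big_nil // !big_cons -IH.
  case: i => [l|x]; last by rewrite big1 // => l _; rewrite /phi /u coeffU mulr0 scale0r.
  rewrite (bigD1 l) //= {1}/phi {1}/u coeffU eqxx mulr1 scale1r big1 ?addr0 // => l' l'l.
  rewrite /phi /u coeffU; have /negPf -> : (inl l' : I) != inl l.
    by apply: contra l'l => /eqP[->].
  by rewrite mulr0 scale0r.
exists (size bs), (size s), (tnth (in_tuple bs)),
  (\matrix_(l, j) (coeff (inl l) (tnth (in_tuple s) j).1)),
  (\matrix_(q, j) (coeff (inr (tnth (in_tuple bs) q)) (tnth (in_tuple s) j).1)),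
  (fun j => (tnth (in_tuple s) j).2); split.
- move=> l; transitivity ((\sum_i phi (u (inl i)) (m i)) (inl l)); first by rewrite vall.
  by rewrite val; apply: eq_bigr => j _; rewrite mxE.
- move=> q; transitivity ((\sum_i phi (u (inl i)) (m i)) (inr (tnth (in_tuple bs) q)));
    last by rewrite vall.
  by rewrite val; apply: eq_bigr => j _; rewrite mxE.
- move=> j; pose p := tnth (in_tuple s) j; have ps : p \in s by exact: mem_tnth.
  rewrite -[RHS](s0 p ps) evE; last exact: all_dom.
  by congr (_ + _); apply: eq_bigr => i _; rewrite mxE.
Qed.

End TensorVanishing.

Section EquationalFlatness.
Variable R : nzRingType.

Definition trivial_relation (M : lmodType R) n (r : 'I_n -> R) (x : 'I_n -> M) : Prop :=
  exists k (B : 'M[R]_(n, k)) (y : 'I_k -> M),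
    (forall i, x i = \sum_j B i j *: y j) /\ (forall j, \sum_i r i * B i j = 0).

(** The equational criterion for flatness. *)
Definition eqflat (M : lmodType R) : Prop :=
  forall n (r : 'I_n -> R) (x : 'I_n -> M),
    \sum_i r i *: x i = 0 -> trivial_relation r x.

Lemma sum_mulmxl (M : lmodType R) n k l (B : 'M[R]_(n, k)) (D : 'M[R]_(k, l))
  (z : 'I_l -> M) i :
  \sum_j B i j *: (\sum_t D j t *: z t) = \sum_t (B *m D) i t *: z t.
Proof.
under eq_bigr do rewrite scaler_sumr.
rewrite exchange_big; apply: eq_bigr => t _; rewrite mxE scaler_suml.
by apply: eq_bigr => j _; rewrite scalerA.
Qed.

(** The equations are made trivial one after the other, each in terms of the
    elements found for the preceding ones. *)
Lemma eqflat_system (M : lmodType R) p k (C : 'M[R]_(p, k)) (y : 'I_k -> M) :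
    eqflat M -> (forall q, \sum_j C q j *: y j = 0) ->
  exists l (D : 'M[R]_(k, l)) (z : 'I_l -> M),
    (forall j, y j = \sum_t D j t *: z t) /\ C *m D = 0.
Proof.
move=> flM; elim: p k C y => [|p IH] k C y Cy.
  exists k, 1%:M, y; split; last by apply/matrixP => -[].
  move=> j; rewrite (bigD1 j) //= mxE eqxx scale1r big1 ?addr0 // => t tj.
  by rewrite mxE eq_sym (negPf tj) scale0r.
have [l1 [D1 [z1 [yz1 CD1]]]] := flM _ _ _ (Cy ord0).
have [|l [D [z [z1z CD]]]] := IH _ (row' ord0 C *m D1) z1.
  move=> q; rewrite -sum_mulmxl -[RHS](Cy (fintype.lift ord0 q)).
  by apply: eq_bigr => j _; rewrite mxE -yz1.
exists l, (D1 *m D), z; split.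
  by move=> j; rewrite -sum_mulmxl yz1; apply: eq_bigr => t _; rewrite z1z.
apply/matrixP => q t; rewrite [RHS]mxE; case: (unliftP ord0 q) => [q' ->|->].
  move/matrixP: CD => /(_ q' t); rewrite [RHS]mxE => <-.
  rewrite -[in RHS]mulmxA [LHS]mxE [RHS]mxE.
  by apply: eq_bigr => j _; rewrite [in RHS]mxE.
rewrite mulmxA mxE big1 // => j _.
by rewrite mxE (CD1 j) mul0r.
Qed.

(** Flatness is applied to the inclusion in [R] of the right ideal generated by
    the coefficients of the relation. *)
Lemma flat_eqflat (M : lmodType R) : flat M -> eqflat M.
Proof.
move=> flM n r x rx0.
pose Rr : lmodType R^c := R^c^o.
pose J : set Rr := [set c | exists d : 'I_n -> R, c = \sum_i r i * d i].
have [|K [i [inji rani]]] := @submod_exists R^c Rr J.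
  apply/submoduleP; split.
    by exists (fun=> 0); rewrite big1 // => l _; rewrite mulr0.
  move=> a _ _ [d ->] [e ->]; exists (fun l => d l * a + e l).
  under [RHS]eq_bigr do rewrite mulrDr mulrA.
  by rewrite big_split -mulr_suml.
have Ji u : J (i u) by rewrite -rani; exists u.
have /choice[s sr] l : exists u, i u = r l.
  suff : J (r l) by rewrite -rani => -[u _ <-]; exists u.
  exists (fun t => (t == l)%:R); rewrite (bigD1 l) //= eqxx mulr1 big1 ?addr0 // => t tl.
  by rewrite (negPf tl) mulr0.
have : \sum_l tmul (s l) (x l) = 0 :> tensor K M.
  apply: (flM _ _ i inji); rewrite raddf0 raddf_sum.
  under eq_bigr do rewrite /= tensor_map_tmul sr.
  have E l : tmul (r l : Rr) (x l) = tmul (1 : Rr) (r l *: x l) :> tensor Rr M.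
    by rewrite -tmulZ; congr tmul; rewrite /GRing.scale /= /GRing.mul /= mul1r.
  by under eq_bigr do rewrite E; rewrite -raddf_sum rx0 raddf0.
move=> /tensor_vanishing[p [k [b [C [C' [y [xy C'y Cb]]]]]]].
(* The additional generators are themselves combinations of the coefficients. *)
have /choice[d bd] q := Ji (b q).
pose D : 'M[R]_(n, p) := \matrix_(l, q) d q l.
exists k, (C + D *m C'), y; split.
  move=> l; under eq_bigr do rewrite mxE scalerDl.
  rewrite big_split -xy -sum_mulmxl big1 /= ?addr0 // => q _.
  by rewrite C'y scaler0.
move=> j; have := congr1 i (Cb j).
rewrite linear0 linearD !linear_sum.
under eq_bigr do rewrite linearZ /= sr.
under [X in _ + X]eq_bigr do rewrite linearZ /= bd.
have scE (c : R) (z : R) : (c : R^c) *: (z : Rr) = z * c by [].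
under eq_bigr do rewrite scE.
under [X in _ + X]eq_bigr do rewrite scE.
move=> Cb0; rewrite -[RHS]Cb0.
under [LHS]eq_bigr do rewrite mxE mulrDr.
rewrite big_split; congr (_ + _).
under [RHS]eq_bigr do rewrite mulr_suml.
rewrite [RHS]exchange_big; apply: eq_bigr => l _; rewrite mxE mulr_sumr.
by apply: eq_bigr => q _; rewrite mxE mulrA.
Qed.

(** The vanishing of the image of a sum of pure tensors is due to finitely many
    relations, which also involve elements outside the image of [A]; by the
    criterion, these can be replaced by relations over [A] alone. *)
Lemma eqflat_flat (M : lmodType R) : eqflat M -> flat M.
Proof.
move=> flM A B f injf; apply: raddf_inj => t.
have [n [a [m ->]]] := tensor_sum t.
rewrite raddf_sum; under eq_bigr do rewrite /= tensor_map_tmul.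
move=> /tensor_vanishing[p [k [b [C [C' [y [my C'y Cb]]]]]]].
have [l [D [z [yz C'D]]]] := eqflat_system flM C'y.
have mz i : m i = \sum_t (C *m D) i t *: z t.
  by rewrite -sum_mulmxl my; apply: eq_bigr => j _; rewrite yz.
under eq_bigr do rewrite mz raddf_sum /=.
rewrite exchange_big big1 // => t' _.
under eq_bigr do rewrite -tmulZ.
rewrite -tmul_suml; suff -> : \sum_i ((C *m D) i t' : R^c) *: a i = 0 by rewrite tmul0l.
apply: injf; rewrite linear0 linear_sum.
under eq_bigr do rewrite linearZ /=.
have comb q' (E : 'M[R]_(q', k)) (c : 'I_q' -> B) :
    \sum_i ((E *m D) i t' : R^c) *: c i =
    \sum_j (D j t' : R^c) *: \sum_i (E i j : R^c) *: c i.
  under [RHS]eq_bigr do rewrite scaler_sumr.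
  rewrite [RHS]exchange_big; apply: eq_bigr => i _; rewrite mxE scaler_suml.
  by apply: eq_bigr => j _; rewrite scalerA.
have b0 : \sum_i ((C' *m D) i t' : R^c) *: b i = 0.
  by rewrite C'D big1 // => i _; rewrite mxE scale0r.
rewrite comb -[LHS]addr0 -[X in _ + X]b0 comb -big_split big1 //= => j _.
by rewrite -scalerDr Cb scaler0.
Qed.

Lemma flatP (M : lmodType R) : flat M <-> eqflat M.
Proof. by split; [exact: flat_eqflat|exact: eqflat_flat]. Qed.

(** * Closure properties of flat modules *)

Lemma trivial_relation_map (M N : lmodType R) (f : {linear M -> N}) n (r : 'I_n -> R) x :
  trivial_relation r x -> trivial_relation r (fun i => f (x i)).
Proof.
move=> [k [B [y [xy rB]]]]; exists k, B, (fun j => f (y j)); split=> // i.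
by rewrite xy linear_sum; apply: eq_bigr => j _; rewrite linearZ.
Qed.

Lemma trivial_relation_ext (M : lmodType R) n (r : 'I_n -> R) (x x' : 'I_n -> M) :
  x =1 x' -> trivial_relation r x -> trivial_relation r x'.
Proof. by move=> xx' [k [B [y [xy rB]]]]; exists k, B, y; split=> // i; rewrite -xx'. Qed.

Lemma trivial_relationD (M : lmodType R) n (r : 'I_n -> R) (x x' : 'I_n -> M) :
  trivial_relation r x -> trivial_relation r x' ->
  trivial_relation r (fun i => x i + x' i).
Proof.
move=> [k [B [y [xy rB]]]] [k' [B' [y' [xy' rB']]]].
exists (k + k')%N, (row_mx B B'), (fun j => match fintype.split j with inl a => y a | inr b => y' b end).
split=> [i|j].
  rewrite big_split_ord /= xy xy'; congr (_ + _); apply: eq_bigr => j _.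
    by rewrite row_mxEl (unsplitK (inl j)).
  by rewrite row_mxEr (unsplitK (inr j)).
rewrite -(splitK j); case: (fintype.split j) => [a|b] /=.
  by under eq_bigr do rewrite row_mxEl; rewrite rB.
by under eq_bigr do rewrite row_mxEr; rewrite rB'.
Qed.

Lemma trivial_relation0 (M : lmodType R) n (r : 'I_n -> R) :
  trivial_relation r (fun=> 0 : M).
Proof. 
exists 0%N, 0, (fun=> 0); split=> [i|[]//]; by rewrite big_ord0.
Qed.

Lemma trivial_relation_sum (M : lmodType R) n (r : 'I_n -> R) I (s : seq I)
    (x : I -> 'I_n -> M) :
  (forall i, trivial_relation r (x i)) -> trivial_relation r (fun l => \sum_(i <- s) x i l).
Proof.
move=> tx; elim: s => [|i s IH].
  apply: trivial_relation_ext (trivial_relation0 M r) => l; by rewrite big_nil.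
by apply: trivial_relation_ext (trivial_relationD (tx i) IH) => l; rewrite big_cons.
Qed.

(** A relation in the pure submodule is trivial in the large module, and
    purity brings the trivializing elements down. *)
Lemma flat_pure (M N : lmodType R) (f : {linear M -> N}) :
  pure_embedding f -> flat N -> flat M.
Proof.
move=> pf /flatP flN; apply/flatP => n r x rx0.
have [|k [B [y [xy rB]]]] := flN n r (fun i => f (x i)).
  rewrite -[RHS](linear0 f) -rx0 linear_sum; apply: eq_bigr => i _.
  by rewrite linearZ.
have [|z zx] := @pure_embedding_reflects _ _ _ f _ _ B x pf.
  by exists y => i; rewrite xy.
by exists k, B, z; split=> // i; rewrite zx.
Qed.

Lemma flat_prod (M N : lmodType R) : flat M -> flat N -> flat (M * N)%type.
Proof.
move=> /flatP flM /flatP flN; apply/flatP => n r x rx0.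
have lin1 : linear (fun u : M => (u, 0 : N)).
  by move=> a u v; congr pair; rewrite /= scaler0 addr0.
have lin2 : linear (fun u : N => (0 : M, u)).
  by move=> a u v; congr pair; rewrite /= scaler0 addr0.
pose i1 := linear_pack lin1; pose i2 := linear_pack lin2.
have t1 : trivial_relation r (fun i => (x i).1).
  by apply: flM; rewrite -[RHS](congr1 fst rx0) (raddf_sum fst).
have t2 : trivial_relation r (fun i => (x i).2).
  by apply: flN; rewrite -[RHS](congr1 snd rx0) (raddf_sum snd).
apply: trivial_relation_ext
  (trivial_relationD (trivial_relation_map i1 t1) (trivial_relation_map i2 t2)) => i /=.
by case: (x i) => u v; congr pair; rewrite /= ?addr0 ?add0r.
Qed.

(** A relation modulo a pure submodule is corrected into a relation by
    elements of the submodule. *)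
Lemma flat_quotient (N Q : lmodType R) (P : set N) (q : {linear N -> Q}) :
    (forall u, exists x, q x = u) -> (forall x, q x = 0 <-> P x) ->
  pure_in P -> flat N -> flat Q.
Proof.
move=> qsurj qker pureP /flatP flN; apply/flatP => n r u ru0.
have /choice[x xu] i := qsurj (u i).
have /qker Prx : q (\sum_i r i *: x i) = 0.
  by rewrite linear_sum -[RHS]ru0; apply: eq_bigr => i _; rewrite linearZ /= xu.
have [||z Pz zx] := pureP 1%N n (\row_i r i) (fun=> \sum_i r i *: x i) => //.
  by exists x => i; apply: eq_bigr => j _; rewrite mxE.
have : trivial_relation r (fun i => x i - z i).
  apply: flN; under eq_bigr do rewrite scalerBr.
  apply/eqP; rewrite sumrB subr_eq0 -(zx ord0); apply/eqP/eq_bigr => i _.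
  by rewrite mxE.
move=> /(trivial_relation_map q); apply: trivial_relation_ext => i.
by rewrite linearB /= xu (qker (z i)).2 ?subr0.
Qed.

End EquationalFlatness.

(** * Direct sums *)

Section DirectSum.
Variables (R : nzRingType) (I : Type) (H : I -> lmodType R).
Local Notation D := (dprod H).
Let Ic : choiceType := {classic I}.

Let finsupp : set D := [set u | exists s : seq Ic, forall i : Ic, i \notin s -> u i = 0].

Let finsupp_sub : submodule finsupp.
Proof.
apply/submoduleP; split; first by exists [::].
move=> a u v [s su] [t tv]; exists (s ++ t) => i; rewrite mem_cat negb_or => /andP[/su ui /tv vi].
by rewrite -[LHS]/(a *: u i + v i) ui vi scaler0 addr0.
Qed.

(** The finite sums are given for tuples, because relations in a direct sum are
    examined in the components of a support common to all their terms. *)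
Lemma direct_sum_exists :
  exists (Z : lmodType R) (inc : forall i, {linear H i -> Z}) (prj : forall i, {linear Z -> H i}),
    [/\ forall i x, prj i (inc i x) = x,
        forall i j x, i <> j -> prj j (inc i x) = 0 &
        forall n (z : 'I_n -> Z), exists s : seq I, forall l, z l = \sum_(i <- s) inc i (prj i (z l))].
Proof.
have [Z [val [injval ranval]]] := submod_exists finsupp_sub.
have Zval z : finsupp (val z) by rewrite -ranval; exists z.
pose delta (i : Ic) (x : H i) : D := fun j : Ic =>
  if i =P j is ReflectT ij then eq_rect i H x j ij else 0.
have deltaE i x : delta i x i = x.
  by rewrite /delta; case: eqP => // ii; rewrite (eq_irrelevance ii erefl).
have delta0 (i j : Ic) x : i <> j -> delta i x j = 0.
  by rewrite /delta; case: eqP.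
have delta_lin i : linear (delta i).
  move=> a x y; apply: functional_extensionality_dep => j.
  rewrite -[RHS]/(a *: delta i x j + delta i y j).
  have [<-|ij] := pselect (i = j); first by rewrite !deltaE.
  by rewrite !delta0 // scaler0 addr0.
have /choice[inc0 inc0E] (p : {i & H i}) : exists z, val z = delta (projT1 p) (projT2 p).
  suff : finsupp (delta (projT1 p) (projT2 p)) by rewrite -ranval => -[z _ <-]; exists z.
  exists [:: projT1 p : Ic] => i; rewrite inE => /eqP ip; apply: delta0 => E; exact: ip.
have inc_lin (i : I) : linear (fun x : H i => inc0 (@existT I (fun i => H i : Type) i x)).
  by move=> a x y; apply: injval; rewrite linearP !inc0E /= delta_lin.
pose inc i := linear_pack (inc_lin i).
have prj_lin i : linear (fun z => val z i) by move=> a x y; rewrite linearP.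
pose prj i := linear_pack (prj_lin i).
exists Z, inc, prj; split.
- by move=> i x /=; rewrite inc0E deltaE.
- by move=> i j x ij /=; rewrite inc0E delta0.
- move=> n z; have /choice[s sz] l := Zval (z l).
  pose t : seq Ic := undup (flatten [seq s l | l <- enum 'I_n]).
  exists t => l; apply: injval.
  apply: functional_extensionality_dep => j.
  have -> : val (\sum_(i <- t) inc i (prj i (z l))) j =
      \sum_(i <- t) (val (inc i (prj i (z l))) j).
    by rewrite linear_sum; elim: t => [|i t IH]; rewrite ?big_nil // !big_cons -IH.
  have E (i : Ic) : val (inc i (prj i (z l))) j = if i == j then val (z l) j else 0.
    rewrite /= inc0E /=; have [<-|/eqP ij] := eqVneq i j; first by rewrite deltaE.
    by rewrite delta0.
  under eq_bigr do rewrite E.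
  have [jt|jt] := boolP ((j : Ic) \in t).
    rewrite (bigD1_seq _ jt (undup_uniq _)) /= eqxx big1 ?addr0 // => i /negPf ij.
    by rewrite ij.
  rewrite big_seq big1 => [|i it]; last first.
    by have [ij|//] := eqVneq i j; rewrite ij (negPf jt) in it.
  apply: sz; apply: contra jt => js; rewrite mem_undup.
  by apply/flattenP; exists (s l) => //; rewrite map_f ?mem_enum.
Qed.

End DirectSum.

Lemma flat_direct_sum (R : nzRingType) (I : Type) (H : I -> lmodType R) (Z : lmodType R)
    (inc : forall i, {linear H i -> Z}) (prj : forall i, {linear Z -> H i}) :
    (forall n (z : 'I_n -> Z), exists s : seq I, forall l,
      z l = \sum_(i <- s) inc i (prj i (z l))) ->
  (forall i, flat (H i)) -> flat Z.
Proof.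
move=> gen flH; apply/flatP => n r x rx0; have [s xs] := gen n x.
have : trivial_relation r (fun l => \sum_(i <- s) inc i (prj i (x l))).
  apply: trivial_relation_sum => i; apply: trivial_relation_map.
  apply: (flatP _).1 => //; rewrite -[RHS](linear0 (prj i)) -rx0 linear_sum.
  by apply: eq_bigr => l _; rewrite linearZ.
by apply: trivial_relation_ext => l; rewrite -xs.
Qed.

(** * Maximal sets above a given one *)

(** The empty chain is the only obstacle to the use of Zorn's lemma for sets of
    sets when the property requires elements; a given initial set removes it. *)
Lemma Zorn_above (T : Type) (P : set (set T)) (S0 : set T) :
    P S0 ->
    (forall F : set (set T), F !=set0 -> F `<=` P -> total_on F subset ->
      P (\bigcup_(X in F) X)) ->
  exists A, [/\ S0 `<=` A, P A & forall B, A `<=` B -> P B -> B `<=` A].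
Proof.
move=> PS0 Pchain; pose Q := [set S : set T | S = set0 \/ (S0 `<=` S /\ P S)].
have [F FQ totF|A [QA maxA]] := @Zorn_bigcup T Q.
  pose F' := F `&` [set S | S0 `<=` S /\ P S].
  have FF' : \bigcup_(X in F) X = \bigcup_(X in F') X.
    apply/seteqP; split=> x [X]; last by move=> [FX _] Xx; exists X.
    move=> FX Xx; exists X => //; split=> //.
    by have [X0|//] := FQ _ FX; rewrite X0 in Xx.
  have [F'0|/set0P[S [FS [S0S PS]]]] := eqVneq F' set0.
    by left; rewrite FF' F'0 bigcup_set0.
  right; rewrite FF'; split.
    by move=> x S0x; exists S; [split|exact: S0S].
  apply: Pchain; first by exists S.
    by move=> X [_ []].
  by move=> X Y [FX _] [FY _]; exact: totF.
have PA : S0 `<=` A /\ P A.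
  case: QA => // A0; have [S00|/eqP S0n] := eqVneq S0 set0.
    by rewrite A0 S00; split => //; rewrite -S00.
  exfalso; apply: (maxA S0); last by right; split.
  by rewrite A0; split=> // S0sub; apply: S0n; apply/seteqP; split.
exists A; split; [exact: PA.1|exact: PA.2|].
move=> B AB PB x Bx; apply: contrapT => Ax; apply: (maxA B).
  by split=> // BA; apply: Ax; exact: BA.
by right; split=> //; exact: subset_trans PA.1 AB.
Qed.

(** * Characters of abelian groups *)

Definition subgroup (X : zmodType) (H : set X) : Prop :=
  H 0 /\ forall x y, H x -> H y -> H (x - y).

Section Subgroup.
Variables (X : zmodType) (H : set X) (subH : subgroup H).

Lemma subgroupN x : H x -> H (- x).
Proof. by move=> Hx; rewrite -sub0r; apply: subH.2 => //; exact: subH.1. Qed.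

Lemma subgroupD x y : H x -> H y -> H (x + y).
Proof. by move=> Hx Hy; rewrite -[y]opprK; apply: subH.2 => //; exact: subgroupN. Qed.

Lemma subgroupMz x (k : int) : H x -> H (x *~ k).
Proof.
move=> Hx; have Hn n : H (x *+ n).
  by elim: n => [|n IH]; [exact: subH.1|rewrite mulrS; exact: subgroupD].
by case: k => n; [exact: Hn|rewrite NegzE mulrNz; exact: (subgroupN (Hn n.+1))].
Qed.

Lemma subgroup_multiples x : exists n : nat, forall k : int, H (x *~ k) <-> (n %| k)%Z.
Proof.
have [ex|none] := pselect (exists n : nat, (0 < n)%N && `[< H (x *+ n) >]); last first.
  exists 0%N => k; split=> [Hk|]; last by rewrite dvd0z => /eqP ->; exact: subH.1.
  rewrite dvd0z; apply: contrapT => /negP k0; apply: none; exists `|k|%N.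
  rewrite absz_gt0 k0; apply/asboolP.
  case: k Hk {k0} => n //; rewrite NegzE mulrNz => /subgroupN.
  by rewrite opprK.
case: (ex_minnP ex) => n /andP[n0 /asboolP Hn] minn; exists n => k.
split=> [Hk|/dvdzP[q ->]]; last first.
  by rewrite mulrC mulrzA; apply: subgroupMz; exact: Hn.
have Hr : H (x *~ (k %% n)%Z).
  have -> : (k %% n)%Z = k - (k %/ n)%Z * n by rewrite {2}(divz_eq k n) addrAC subrr add0r.
  rewrite mulrzBr; apply: subH.2 => //.
  by rewrite mulrC mulrzA; apply: subgroupMz; exact: Hn.
have : (0 <= k %% n)%Z by rewrite modz_ge0 // eqz_nat -lt0n.
have rn := ltz_pmod k (n0 : (0 < n%:Z)%R).
move=> r0; apply/dvdz_mod0P; move: Hr rn r0; case: (k %% n)%Z => // -[//|r] Hr rn _.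
by have := minn r.+1 (asboolT Hr); rewrite leqNgt -ltz_nat rn.
Qed.

End Subgroup.

Definition divisible (T : zmodType) : Prop :=
  forall (t : T) n, (0 < n)%N -> exists s, s *+ n = t.

(** Divisible abelian groups are injective: a partial homomorphism with
    maximal domain, given by its graph, is total, since a value at a new
    element [x] only has to be divided by the order of [x] modulo the domain. *)
Lemma divisible_extension (X T : zmodType) (G : set (X * T)) :
    divisible T -> subgroup G -> (forall t, G (0, t) -> t = 0) ->
  exists2 f : X -> T, zmod_morphism f & forall x t, G (x, t) -> f x = t.
Proof.
move=> divT sG G0.
pose P := [set G : set (X * T) | subgroup G /\ forall t, G (0, t) -> t = 0].
have [||A [GA [sA A0] maxA]] := @Zorn_above _ P G; first by [].
  move=> F [S FS] FP totF; split; last first.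
    by move=> t [Y /FP[_ +]]; exact.
  split; first by exists S => //; exact: (FP _ FS).1.1.
  move=> x y [Y FY Yx] [Z FZ Zy].
  have [YZ|ZY] := totF _ _ FY FZ; [exists Z => //|exists Y => //].
    by apply: (FP _ FZ).1.2 => //; exact: YZ.
  by apply: (FP _ FY).1.2 => //; exact: ZY.
suff tot : forall x, exists t, A (x, t).
  have /choice[f Af] := tot; exists f => [x y|x t /GA Axt].
    apply/eqP; rewrite -subr_eq0; apply/eqP/A0.
    by have := sA.2 _ _ (Af (x - y)) (sA.2 _ _ (Af x) (Af y)); rewrite /= -[X in A X]/(_, _) subrr.
  apply/eqP; rewrite -subr_eq0; apply/eqP/A0.
  by have := sA.2 _ _ (Af x) Axt; rewrite -[X in A X]/(_, _) /= subrr.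
move=> x; pose dA := [set x | exists t, A (x, t)].
have sdA : subgroup dA.
  split; first by exists 0; exact: sA.1.
  by move=> y z [s As] [t At]; exists (s - t); exact: (sA.2 _ _ As At).
have [n nP] := subgroup_multiples sdA x.
have [t tP] : exists t, forall k s, A (x *~ k, s) -> s = t *~ k.
  have [n0|n0] := posnP n.
    exists 0 => k s Aks; rewrite mul0rz; apply: A0.
    have /nP : dA (x *~ k) by exists s.
    by rewrite n0 dvd0z => /eqP k0; rewrite k0 in Aks.
  have /(nP n)[s As] : (n%:Z %| n%:Z)%Z by exact: dvdzz.
  have [t tn] := divT s n n0; exists t => k u Au.
  have /nP/dvdzP[q kq] : dA (x *~ k) by exists u.
  apply/eqP; rewrite -subr_eq0; apply/eqP/A0.
  have -> : (0, u - t *~ k) = (x *~ k, u) - (x *~ n, s) *~ q.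
    have pz (z : X * T) : z *~ q = (z.1 *~ q, z.2 *~ q).
      by rewrite [LHS]surjective_pairing !raddfMz.
    by rewrite pz /= -tn kq mulrC !mulrzA; congr pair; rewrite /= subrr.
  by apply: sA.2 => //; exact: subgroupMz.
pose B := [set p : X * T | exists (q : X * T) (k : int), A q /\ p = (q.1 + x *~ k, q.2 + t *~ k)].
have AB : A `<=` B.
  by move=> [y s] As; exists (y, s), 0; rewrite !mulr0z !addr0.
have : B `<=` A.
  apply: maxA => //; split.
    split; first by apply: AB; exact: sA.1.
    move=> _ _ [q [k [Aq ->]]] [r [l [Ar ->]]]; exists (q - r), (k - l); split.
      exact: sA.2.
    by rewrite !mulrzBr; congr pair => /=; rewrite opprD addrACA.
  move=> s [[y u] [k [Ay [y0 ->]]]] /=.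
  have /tP -> : A (x *~ (- k), u).
    by rewrite mulrNz -[- _]add0r y0 addrK.
  by rewrite mulrNz addNr.
by move=> /(_ (x, t)) BA; exists t; apply: BA; exists (0, 0), 1; rewrite !add0r; split => //; exact: sA.1.
Qed.

Definition has_torsion (T : zmodType) : Prop :=
  forall n, n <> 1%N -> exists t : T, t <> 0 /\ t *+ n = 0.

(** The character is prescribed on [H] and at [x], where its value must have an
    order dividing that of [x] modulo [H]. *)
Lemma character_separation (X T : zmodType) (H : set X) (x : X) :
    divisible T -> has_torsion T -> subgroup H -> ~ H x ->
  exists f : X -> T, [/\ zmod_morphism f, forall h, H h -> f h = 0 & f x <> 0].
Proof.
move=> divT torT sH Hx; have [n nP] := subgroup_multiples sH x.
have [|t [t0 tn]] := torT n.
  by move=> n1; apply: Hx; apply/(nP 1); rewrite n1.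
pose G := [set p : X * T | exists (h : X) (k : int), H h /\ p = (h + x *~ k, t *~ k)].
have [|||f fB fG] := @divisible_extension X T G.
- exact: divT.
- split; first by exists 0, 0; rewrite addr0; split=> //; exact: sH.1.
  move=> _ _ [h [k [Hh ->]]] [g [l [Hg ->]]]; exists (h - g), (k - l).
  split; first exact: sH.2.
  by rewrite !mulrzBr; congr pair => /=; rewrite opprD addrACA.
- move=> s [h [k [Hh [h0 ->]]]].
  have /nP/dvdzP[q ->] : H (x *~ k).
    have -> : x *~ k = - h by apply/eqP; rewrite -addr_eq0 addrC -h0.
    exact: subgroupN.
  by rewrite mulrC mulrzA -pmulrn tn mul0rz.
exists f; split=> // [h Hh|fx0]; first by apply: fG; exists h, 0; rewrite addr0.
apply: t0; rewrite -fx0; apply/esym/fG; exists 0, 1; rewrite add0r; split => //; exact: sH.1.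
Qed.

(** The group is [rat] modulo the integers. *)
Lemma divisible_torsion_exists : exists T : zmodType, divisible T /\ has_torsion T.
Proof.
pose Q : lmodType int := zmodule rat.
pose Z : set Q := [set x | exists k : int, x = k%:~R :> rat].
have sZ : submodule Z.
  apply/submoduleP; split; first by exists 0.
  move=> a _ _ [k ->] [l ->]; exists (k * a + l).
  by rewrite intrD intrM mulrzr.
exists (quotmod sZ); split.
  move=> t n n0; have [x <-] := quot_proj_surj t.
  exists (quot_proj sZ ((x : rat) / n%:R)); rewrite -raddfMn /=; congr quot_proj.
  by rewrite -[LHS](mulr_natr (_ : rat)) mulfVK // Num.Theory.pnatr_eq0 -lt0n.
move=> n n1; have [n0|n0] := posnP n.
  exists (quot_proj sZ (2%:R^-1 : rat)); rewrite n0; split=> // /quot_proj_eq0[k].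
  move=> /(congr1 (fun x : rat => x * 2%:R)); rewrite mulVf //.
  rewrite -[1]/(1%:~R) -[2%:R]/(2%:~R) -intrM => /eqP; rewrite eqr_int.
  by move=> /eqP/(congr1 (fun k : int => (2 %| k)%Z)); rewrite dvdz_mull.
have nn0 : n%:R != 0 :> rat by rewrite Num.Theory.pnatr_eq0 -lt0n.
exists (quot_proj sZ (n%:R^-1 : rat)); split.
  move=> /quot_proj_eq0[k] /(congr1 (fun x : rat => x * n%:R)); rewrite mulVf //.
  rewrite -[1]/(1%:~R) -[n%:R]/((n%:Z)%:~R) -intrM => /eqP; rewrite eqr_int.
  move=> /eqP/(congr1 (fun k : int => (n %| k)%Z)); rewrite dvdz_mull //.
  by rewrite dvdz1 absz_nat => /eqP; exact: n1.
rewrite -raddfMn; apply/quot_proj_eq0; exists 1.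
by rewrite -[LHS](mulr_natr (_ : rat)) mulVf.
Qed.

(** * Character modules and pure-injective extensions *)

Section CharacterModule.
Variables (S S' : nzRingType) (tau : S' -> S).
Hypotheses (tauD : forall a b, tau (a + b) = tau a + tau b) (tau1 : tau 1 = 1)
  (tauM : forall a b, tau (a * b) = tau b * tau a).
Variables (X : lmodType S) (T : zmodType).

Definition additive_pred : {pred X -> T} := fun f => `[< zmod_morphism f >].

Fact additive_pred_closed : zmod_closed additive_pred.
Proof.
split=> [|f g /asboolP fB /asboolP gB]; apply/asboolP => x y.
  by rewrite /= subrr.
by rewrite -[LHS]/(f (x - y) - g (x - y)) fB gB !opprD !opprK addrACA.
Qed.

HB.instance Definition _ := GRing.isZmodClosed.Build (X -> T) additive_pred
  additive_pred_closed.

Record char := Char { char_val : X -> T; _ : char_val \in additive_pred }.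
HB.instance Definition _ := [isSub for char_val].
HB.instance Definition _ := [Choice of char by <:].
HB.instance Definition _ := [SubChoice_isSubZmodule of char by <:].

Lemma charB (d : char) : zmod_morphism (char_val d).
Proof. exact/asboolP/(valP d). Qed.

Lemma charD (d : char) x y : char_val d (x + y) = char_val d x + char_val d y.
Proof.
by have := charB d (x + y) y; rewrite addrK => ->; rewrite subrK.
Qed.

(** The scalars act on the argument through an anti-morphism [tau], so as to
    cover both the dual of a left module and the dual of a right module. The
    laws of [tau] are parameters because the module structure depends on them. *)
Definition charmod of (forall a b, tau (a + b) = tau a + tau b) & (tau 1 = 1) &
  (forall a b, tau (a * b) = tau b * tau a) : Type := char.
Local Notation D := (charmod tauD tau1 tauM).
HB.instance Definition _ := GRing.Zmodule.on D.

Fact char_scale_subproof a (d : D) :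
  (fun x => char_val d (tau a *: x)) \in additive_pred.
Proof. by apply/asboolP => x y; rewrite scalerBr charB. Qed.

Definition char_scale a (d : D) : D := Char (char_scale_subproof a d).

Fact char_scaleA a b d : char_scale a (char_scale b d) = char_scale (a * b) d.
Proof.
by apply/val_inj/functional_extensionality_dep => x /=; rewrite tauM scalerA.
Qed.
Fact char_scale1 d : char_scale 1 d = d.
Proof.
by apply/val_inj/functional_extensionality_dep => x /=; rewrite tau1 scale1r.
Qed.
Fact char_scaleDr a : {morph char_scale a : d e / d + e}.
Proof. by move=> d e; apply/val_inj/functional_extensionality_dep => x. Qed.
Fact char_scaleDl d : {morph char_scale^~ d : a b / a + b}.
Proof.
move=> a b; apply/val_inj/functional_extensionality_dep => x /=.
by rewrite tauD scalerDl charD.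
Qed.

HB.instance Definition _ := GRing.Zmodule_isLmodule.Build S' D
  char_scaleA char_scale1 char_scaleDr char_scaleDl.

End CharacterModule.

Lemma charmod_exists (S S' : nzRingType) (tau : S' -> S) (X : lmodType S) (T : zmodType) :
    (forall a b, tau (a + b) = tau a + tau b) -> tau 1 = 1 ->
    (forall a b, tau (a * b) = tau b * tau a) ->
  exists (D : lmodType S') (ev : D -> X -> T),
    [/\ forall d, zmod_morphism (ev d),
        forall a d x, ev (a *: d) x = ev d (tau a *: x),
        forall d e x, ev (d + e) x = ev d x + ev e x,
        forall f, zmod_morphism f -> exists d, ev d =1 f &
        forall d e, ev d =1 ev e -> d = e].
Proof.
move=> tauD tau1 tauM; exists (charmod X T tauD tau1 tauM), (@char_val _ X T); split=> //.
- exact: charB.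
- by move=> f fB; exists (Char (asboolT fB : f \in @additive_pred _ X T)).
- by move=> d e de; apply/val_inj/functional_extensionality_dep.
Qed.

Section DoubleDual.
Variables (R : nzRingType) (T : zmodType) (M : lmodType R).
Hypotheses (divT : divisible T) (torT : has_torsion T).
Variables (D1 : lmodType R^c) (ev1 : D1 -> M -> T).
Hypotheses (ev1B : forall d, zmod_morphism (ev1 d))
  (ev1Z : forall a d x, ev1 (a *: d) x = ev1 d ((a : R) *: x))
  (ev1D : forall d e x, ev1 (d + e) x = ev1 d x + ev1 e x)
  (ev1_onto : forall f, zmod_morphism f -> exists d, ev1 d =1 f)
  (ev1_inj : forall d e, ev1 d =1 ev1 e -> d = e).
Variables (D2 : lmodType R) (ev2 : D2 -> D1 -> T).
Hypotheses (ev2B : forall d, zmod_morphism (ev2 d))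
  (ev2Z : forall (a : R) d x, ev2 (a *: d) x = ev2 d ((a : R^c) *: x))
  (ev2D : forall d e x, ev2 (d + e) x = ev2 d x + ev2 e x)
  (ev2_onto : forall f, zmod_morphism f -> exists d, ev2 d =1 f)
  (ev2_inj : forall d e, ev2 d =1 ev2 e -> d = e).

Let zmodD (U V : zmodType) (f : U -> V) x y : zmod_morphism f -> f (x + y) = f x + f y.
Proof. by move=> fB; have := fB (x + y) y; rewrite addrK => ->; rewrite subrK. Qed.

Let zmod0 (U V : zmodType) (f : U -> V) : zmod_morphism f -> f 0 = 0.
Proof. by move=> fB; rewrite -(subrr 0) fB subrr. Qed.

Let ev1_0 x : ev1 0 x = 0.
Proof. by apply: (addrI (ev1 0 x)); rewrite -ev1D !addr0. Qed.

Let ev2_0 x : ev2 0 x = 0.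
Proof. by apply: (addrI (ev2 0 x)); rewrite -ev2D !addr0. Qed.

Let ev2_suml I (r : seq I) (F : I -> D2) x :
  ev2 (\sum_(i <- r) F i) x = \sum_(i <- r) ev2 (F i) x.
Proof. by elim: r => [|i r IH]; rewrite ?big_nil ?ev2_0 // !big_cons ev2D IH. Qed.

Let ev1_suml I (r : seq I) (F : I -> D1) x :
  ev1 (\sum_(i <- r) F i) x = \sum_(i <- r) ev1 (F i) x.
Proof. by elim: r => [|i r IH]; rewrite ?big_nil ?ev1_0 // !big_cons ev1D IH. Qed.

(** If a system over [M] is not soluble in [M], a character of a power of [M]
    vanishing on the image of the matrix but not at the right-hand side
    shows that it is not soluble in the double dual. *)
Lemma double_dual_embedding : exists i : {linear M -> D2}, pure_embedding i.
Proof.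
have /choice[i iE] : forall x, exists d2, forall d, ev2 d2 d = ev1 d x.
  move=> x; apply: ev2_onto => d e; apply/eqP; rewrite eq_sym subr_eq -ev1D.
  by rewrite subrK.
have lin_i : linear i.
  move=> a x y; apply: ev2_inj => d.
  by rewrite ev2D ev2Z !iE ev1Z zmodD.
exists (linear_pack lin_i); apply/pure_embeddingP => m k A v _ [y yv].
apply: contrapT => nsol.
pose X : zmodType := ('I_m -> M).
pose H := [set w : X | soluble A w].
have [||f [fB fH fv]] := @character_separation X T H v divT torT.
- split; first by exists (fun=> 0) => l; rewrite big1 // => j _; rewrite scaler0.
  by move=> w w' Hw Hw'; apply: soluble_ext (solubleB Hw Hw').
- exact: nsol.
apply: fv.
pose delta (l : 'I_m) (x : M) : X := fun l' => if l' == l then x else 0.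
have deltaB l : zmod_morphism (delta l).
  move=> x x'; apply: functional_extensionality_dep => l'.
  by rewrite -[RHS]/(delta l x l' - delta l x' l') /delta; case: eqP; rewrite ?subrr.
have /choice[chi chiE] : forall l, exists d, forall x, ev1 d x = f (delta l x).
  by move=> l; apply: ev1_onto => x x'; rewrite deltaB fB.
have fsum w : f w = \sum_l ev1 (chi l) (w l).
  under eq_bigr do rewrite chiE.
  rewrite -zmod_morphism_sum //; congr f; apply: functional_extensionality_dep => l.
  have -> : (\sum_i0 delta i0 (w i0)) l = \sum_i0 delta i0 (w i0) l.
    by elim: (index_enum _) => [|j s IH]; rewrite ?big_nil // !big_cons -IH.
  rewrite (bigD1 l) //= {1}/delta eqxx big1 ?addr0 // => l' l'l.
  by rewrite /delta eq_sym (negPf l'l).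
have chiA j : \sum_l (A l j : R^c) *: chi l = 0.
  apply: ev1_inj => x; rewrite ev1_suml ev1_0.
  under eq_bigr do rewrite ev1Z.
  rewrite -(fsum (fun l => A l j *: x)); apply: fH.
  exists (fun j' => if j' == j then x else 0) => l.
  rewrite (bigD1 j) //= eqxx big1 ?addr0 // => j' /negPf ->.
  by rewrite scaler0.
have {}yv l : \sum_j A l j *: y j = i (v l) := yv l.
rewrite fsum; under eq_bigr do rewrite -iE -yv ev2_suml.
rewrite exchange_big big1 //= => j _.
under eq_bigr do rewrite ev2Z.
by rewrite -zmod_morphism_sum // chiA zmod0.
Qed.

(** A homomorphism [g] from a pure submodule [P] of [N] to the double dual is
    an additive map on a tensor product, which is extended along the map
    induced by the inclusion of [P] in [N]: the latter is injective, because a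
    vanishing sum of pure tensors of elements of [P] vanishes for reasons that
    can be found in [P]. *)
Lemma double_dual_pure_injective : pure_injective D2.
Proof.
move=> P N i g puri.
pose G := [set p : tensor D1 N * T | exists s : seq (D1 * P),
  p = (\sum_(q <- s) tmul q.1 (i q.2), \sum_(q <- s) ev2 (g q.2) q.1)].
have [|t [s [s0 ->]]|Th ThB ThG] := @divisible_extension (tensor D1 N) T G divT.
- split; first by exists [::]; rewrite !big_nil.
  move=> _ _ [s ->] [s' ->]; exists (s ++ [seq (q.1, - q.2) | q <- s']).
  rewrite !big_cat !big_map /=; congr pair; rewrite /= -sumrN; congr (_ + _).
    by apply: eq_bigr => q _; rewrite /= linearN raddfN.
  apply: eq_bigr => q _; rewrite /= linearN -scaleN1r ev2Z.
  by rewrite scaleN1r -[- q.1]sub0r ev2B zmod0 // sub0r.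
- pose a l := (tnth (in_tuple s) l).2; pose chi l := (tnth (in_tuple s) l).1.
  rewrite big_tnth -/(\sum_l ev2 (g (a l)) (chi l)).
  have : \sum_l tmul (chi l) (i (a l)) = 0 :> tensor D1 N.
    by rewrite [RHS]s0 [RHS]big_tnth.
  move=> /tensor_vanishing[p [k [b [C [C' [y [ay C'y chib]]]]]]].
  (* The extra rows are part of the system: they must vanish in P as well. *)
  have [|z zP] := @pure_embedding_reflects _ _ _ i _ _ (col_mx C C')
    (fun l => match fintype.split l with inl l => a l | inr _ => 0 end) puri.
    exists y => l; rewrite -(splitK l); case: (fintype.split l) => [l'|q] /=.
      rewrite (unsplitK (inl l')) ay; apply: eq_bigr => j _; by rewrite col_mxEu.
    rewrite (unsplitK (inr q)) linear0 -[RHS](C'y q).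
    by apply: eq_bigr => j _; rewrite col_mxEd.
  have az l : a l = \sum_j C l j *: z j.
    have := zP (lshift p l); rewrite (unsplitK (inl l)) /= => <-.
    by apply: eq_bigr => j _; rewrite col_mxEu.
  have z0 q : \sum_j C' q j *: z j = 0.
    have := zP (rshift _ q); rewrite (unsplitK (inr q)) /= => zq; rewrite -[RHS]zq.
    by apply: eq_bigr => j _; rewrite col_mxEd.
  have evsum n' (E : 'M[R]_(n', k)) (c : 'I_n' -> D1) :
      \sum_l ev2 (g (\sum_j E l j *: z j)) (c l) =
      \sum_j ev2 (g (z j)) (\sum_l (E l j : R^c) *: c l).
    under [RHS]eq_bigr do rewrite zmod_morphism_sum //.
    rewrite [RHS]exchange_big; apply: eq_bigr => l _; rewrite linear_sum ev2_suml.
    by apply: eq_bigr => j _; rewrite linearZ /= ev2Z.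
  under eq_bigr do rewrite az.
  rewrite evsum -[LHS]addr0.
  have b0 : \sum_q ev2 (g (\sum_j C' q j *: z j)) (b q) = 0.
    by rewrite big1 // => q _; rewrite z0 linear0 ev2_0.
  rewrite -[X in _ + X]b0 evsum -big_split big1 //= => j _.
  by rewrite -zmodD // chib zmod0.
have /choice[h hE] : forall b, exists d2, forall d, ev2 d2 d = Th (tmul d b).
  by move=> b; apply: ev2_onto => d e; rewrite tmul_zmod_l ThB.
have lin_h : linear h.
  move=> a x y; apply: ev2_inj => d.
  by rewrite ev2D ev2Z !hE -zmodD // tmulZ -raddfD.
exists (linear_pack lin_h) => x; apply: ev2_inj => d /=.
by rewrite hE; apply: ThG; exists [:: (d, x)]; rewrite !big_seq1.
Qed.

End DoubleDual.

Lemma pure_injective_extension (R : nzRingType) (M : lmodType R) :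
  exists (E : lmodType R) (i : {linear M -> E}), pure_injective E /\ pure_embedding i.
Proof.
have [T [divT torT]] := divisible_torsion_exists.
have [|||D1 [ev1 [B1 Z1 A1 onto1 inj1]]] := @charmod_exists R R^c id M T => //.
have [|||D2 [ev2 [B2 Z2 A2 onto2 inj2]]] := @charmod_exists R^c R id D1 T => //.
have [i puri] := double_dual_embedding divT torT B1 Z1 A1 onto1 inj1 B2 Z2 A2 onto2 inj2.
exists D2, i; split=> //; have pi := double_dual_pure_injective divT B2 Z2 A2 onto2 inj2; exact: pi.
Qed.

(** * Extension of partial homomorphisms into pure-injective modules *)

(** The graph of a partial homomorphism that preserves positive primitive
    types; it is single-valued by [soluble0]. *)
Definition pp_graph (R : nzRingType) (X E : lmodType R) (G : set (X * E)) : Prop :=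
  submodule G /\
  forall m k (A : 'M[R]_(m, k)) (v : 'I_m -> X) (w : 'I_m -> E),
    (forall i, G (v i, w i)) -> soluble A v -> soluble A w.

(** The pushout of [E] and [X] over [G] is a pure extension of [E], which
    therefore retracts onto [E]. *)
Lemma pure_injective_extends (R : nzRingType) (X E : lmodType R) (G : set (X * E)) :
  pure_injective E -> pp_graph G ->
  exists h : {linear X -> E}, forall x e, G (x, e) -> h x = e.
Proof.
move=> piE [sG ppG].
pose K := [set p : X * E | G (p.1, - p.2)].
have sK : submodule K.
  apply/submoduleP; split; first by rewrite /K /= oppr0; exact: submodule0 sG.
  move=> a u v Ku Kv; rewrite /K /= opprD -scalerN.
  exact: (submoduleD sG (submoduleZ sG a Ku) Kv).
pose q : {linear (X * E)%type -> quotmod sK} := quot_proj sK.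
have lin_j : linear (fun e : E => q (0, e)).
  move=> a e e'; rewrite -linearP; congr (q (_, _)).
  by rewrite /= scaler0 addr0.
have lin_x : linear (fun x : X => q (x, 0)).
  move=> a x x'; rewrite -linearP; congr (q (_, _)).
  by rewrite /= scaler0 addr0.
have [|r rj] := piE E _ (linear_pack lin_j) idfun.
  apply/pure_embeddingP => m k A w _ [y yw].
  have /choice[u uy] : forall j, exists u, q u = y j by move=> j; exact: quot_proj_surj.
  have Gu l : G (\sum_j A l j *: (u j).1, w l - \sum_j A l j *: (u j).2).
    have : q (\sum_j A l j *: u j) = q (0, w l).
      by rewrite -[RHS]yw linear_sum; apply: eq_bigr => j _; rewrite linearZ /= uy.
    move=> /quot_proj_eq; rewrite /K /= subr0 opprB.
    rewrite (raddf_sum fst) (raddf_sum snd); congr G; congr (_, _ - _).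
  have := ppG _ _ _ _ _ Gu (soluble_comb A _).
  move=> /solubleD/(_ (soluble_comb A (fun j => (u j).2))).
  by apply: soluble_ext => l; rewrite subrK.
exists (r \o linear_pack lin_x) => x e Gxe.
rewrite -[RHS](rj e) /=; congr (r _); apply/quot_proj_eq.
by rewrite /K /= subr0 sub0r opprK.
Qed.

(** * Hulls *)

Lemma directed_bound (I : Type) (le : I -> I -> Prop) m (F : 'I_m -> I) :
    I -> (forall i, le i i) -> (forall i j k, le i j -> le j k -> le i k) ->
    (forall i j, le i j \/ le j i) ->
  exists i, forall l, le (F l) i.
Proof.
move=> i0 le_refl le_trans le_tot; elim: m F => [|m IH] F; first by exists i0 => -[].
have [i Fi] := IH (fun l => F (fintype.lift ord0 l)).
have [le0|le0] := le_tot (F ord0) i; [exists i|exists (F ord0)] => l;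
  case: (unliftP ord0 l) => [l' ->|->] //.
exact: le_trans (Fi l') le0.
Qed.

Lemma chain_tuple (T : Type) (F : set (set T)) m (v : 'I_m -> T) :
    F !=set0 -> total_on F subset -> (forall i, (\bigcup_(S in F) S) (v i)) ->
  exists2 S, F S & forall i, S (v i).
Proof.
move=> [S0 FS0] totF Fv.
have /choice[S SP] : forall i, exists S : {S | F S}, sval S (v i).
  by move=> i; have [S FS Sv] := Fv i; exists (exist _ S FS).
have [||||[X FX] Xb] := @directed_bound {S | F S} (fun S S' => sval S `<=` sval S') m S.
- by exists S0.
- by move=> i; exact: subset_refl.
- by move=> i j k; exact: subset_trans.
- by move=> [X FX] [Y FY]; exact: totF.
by exists X => // i; exact: (Xb i).
Qed.

Lemma chain_submodule (R : nzRingType) (N : lmodType R) (F : set (set N)) :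
    F !=set0 -> total_on F subset -> (forall S, F S -> submodule S) ->
  submodule (\bigcup_(S in F) S).
Proof.
move=> [S0 FS0] totF subF; apply/submoduleP; split.
  by exists S0 => //; exact: submodule0 (subF _ FS0).
move=> a u v [X FX Xu] [Y FY Yv].
have [XY|YX] := totF _ _ FX FY.
  exists Y => //.
  exact: (submoduleD (subF _ FY) (submoduleZ (subF _ FY) a (XY _ Xu)) Yv).
exists X => //.
exact: (submoduleD (subF _ FX) (submoduleZ (subF _ FX) a Xu) (YX _ Yv)).
Qed.

Section Hull.
Variables (R : nzRingType) (E : lmodType R).
Hypothesis piE : pure_injective E.

(** For [C] contained in [D], the analogue of an essential extension in which
    injectivity is replaced by the reflection of solubility. *)
Definition pp_essential (C D : set E) : Prop :=
  forall (Y : lmodType R) (f : {linear E -> Y}), reflecting f C -> reflecting f D.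

Definition fixes (D : set E) (e : {linear E -> E}) : Prop := forall d, D d -> e d = d.

Definition more_soluble (e e' : {linear E -> E}) : Prop :=
  forall m k (A : 'M[R]_(m, k)) v,
    soluble A (fun i => e (v i)) -> soluble A (fun i => e' (v i)).

Lemma reflecting_extends (D : set E) (Y : lmodType R) (f : {linear E -> Y}) :
  submodule D -> reflecting f D -> exists g : {linear Y -> E}, fixes D (g \o f).
Proof.
move=> sD fD; pose G := [set p : Y * E | D p.2 /\ p.1 = f p.2].
have [|g gG] := @pure_injective_extends R Y E G piE; last first.
  by exists g => d Dd; apply: gG.
split; last first.
  move=> m k A v w Gvw sv; apply: fD => [i|]; first exact: (Gvw i).1.
  by apply: soluble_ext sv => i; exact: (Gvw i).2.
apply/submoduleP; split; first by split=> /=; [exact: submodule0 sD|rewrite linear0].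
move=> a u v [Du u1] [Dv v1]; split; last by rewrite -[X in f X]/(a *: u.2 + v.2) linearP -u1 -v1.
exact: submoduleD (submoduleZ sD _ Du) Dv.
Qed.

(** A chain of endomorphisms defines a homomorphism from [E] to a power of [E]
    modulo the families that eventually vanish. This homomorphism reflects
    solubility over [D] and makes soluble each system that one of the
    endomorphisms makes soluble; it is brought back to [E] by
    pure-injectivity, and then bounds the chain. *)
Lemma maximal_endomorphism (D : set E) :
  submodule D ->
  exists2 e, fixes D e & forall e', fixes D e' -> more_soluble e e' -> more_soluble e' e.
Proof.
move=> sD; pose S := {e : {linear E -> E} | fixes D e}.
pose le (e e' : S) : bool := `[< more_soluble (sval e) (sval e') >].
have le_refl e : le e e by apply/asboolP.
have le_trans e e' e'' : le e e' -> le e' e'' -> le e e''.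
  by move=> /asboolP H /asboolP H'; apply/asboolP => m k A v /H/H'.
have id_fix : fixes D idfun by [].
suff bound A : total_on A le -> exists t, forall s, A s -> le s t.
  have [[e fe] maxe] := @ZL_preorder S (exist _ (idfun : {linear E -> E}) id_fix) le le_refl le_trans bound.
  exists e => // e' fe' ee'; have := maxe (exist _ e' fe').
  by move=> /(_ (asboolT ee'))/asboolP.
move=> totA; have [[a0 Aa0]|A0] := pselect (exists a, A a); last first.
  by exists (exist _ (idfun : {linear E -> E}) id_fix) => s As; case: A0; exists s.
pose I := {e : S | A e}.
pose leI (i j : I) : Prop := le (sval i) (sval j).
have i0 : I by exists a0.
have leI_tot i j : leI i j \/ leI j i by exact: totA (svalP i) (svalP j).
have leI_trans i j k : leI i j -> leI j k -> leI i k by exact: le_trans.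
pose P : lmodType R := dprod (fun _ : I => E).
pose small := [set u : P | exists i0, forall i, leI i0 i -> u i = 0].
have s_small : submodule small.
  apply/submoduleP; split; first by exists i0.
  move=> a u v [i ui] [j vj].
  have [ij|ji] := leI_tot i j; [exists j|exists i] => k le_k.
    by rewrite -[LHS]/(a *: u k + v k) ui ?vj ?scaler0 ?addr0 //; exact: leI_trans le_k.
  by rewrite -[LHS]/(a *: u k + v k) ui ?vj ?scaler0 ?addr0 //; exact: leI_trans le_k.
pose q : {linear P -> quotmod s_small} := quot_proj s_small.
pose diag (x : E) : P := fun i => sval (sval i) x.
have lin_f : linear (fun x => q (diag x)).
  move=> a x y; transitivity (q (a *: diag x + diag y)); last exact: linearP.
  by congr (q _); apply: functional_extensionality_dep => i; exact: linearP.
have sum_at n (b : 'I_n -> R) (u : 'I_n -> P) i :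
    (\sum_j b j *: u j : P) i = \sum_j b j *: u j i.
  by elim: (index_enum _) => [|j s IH]; rewrite ?big_nil // !big_cons -IH.
have [|g gf] := @reflecting_extends D _ (linear_pack lin_f) sD.
  move=> m k B v Dv [y yv].
  have /choice[u uy] : forall j, exists u, q u = y j by move=> j; exact: quot_proj_surj.
  have /choice[i iP] : forall l, exists i, forall j, leI i j ->
      \sum_t B l t *: u t j = v l.
    move=> l; have : q (\sum_t B l t *: u t) = q (diag (v l)).
      by rewrite -[RHS]yv linear_sum; apply: eq_bigr => j _; rewrite linearZ /= uy.
    move=> /quot_proj_eq[i ui]; exists i => j /ui/eqP; rewrite subr_eq0 sum_at => /eqP ->.
    exact: (svalP (sval j)).
  have [j jP] := directed_bound i i0 (fun i => le_refl _) leI_trans leI_tot.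
  by exists (fun t => u t j) => l; exact: iP.
exists (exist _ (g \o linear_pack lin_f : {linear E -> E}) gf) => e Ae; apply/asboolP => m k B v sv.
have : soluble B (fun l => linear_pack lin_f (v l)); last exact: soluble_map.
pose i : I := exist _ e Ae.
have /choice[y yP] : forall j, exists y : 'I_k -> E, leI i j ->
    forall l, \sum_t B l t *: y t = diag (v l) j.
  move=> j; have [/asboolP ij|] := pselect (leI i j); last by exists (fun=> 0).
  by have [y yv] := ij _ _ _ _ sv; exists y.
exists (fun t => q (fun j => y j t)) => l.
transitivity (q (\sum_t B l t *: (fun j => y j t : E) : P)).
  by rewrite linear_sum; apply: eq_bigr => t _; rewrite linearZ.
apply/quot_proj_eq; exists i => j ij; apply/eqP; rewrite subr_eq0; apply/eqP.
by rewrite sum_at; exact: yP.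
Qed.

(** Let [D] be maximal among the essential extensions of [C], and let [e] be an
    endomorphism fixing [D] that makes as many systems as possible soluble. The
    image of [e] is still essential: if [f] reflects solubility over [D], then
    some [g] undoes it there, and [f] cannot make more systems soluble over the
    image of [e], as otherwise [g \o f \o e] would do better than [e]. By the
    choice of [D], the image of [e] is [D], so [e] is a projection. *)
Lemma hull_exists (C : set E) : submodule C ->
  exists e : {linear E -> E}, [/\ forall x, e (e x) = e x, fixes C e & pp_essential C (range e)].
Proof.
move=> sC.
pose P := [set D : set E | submodule D /\ pp_essential C D].
have [||D [CD [sD essD] maxD]] := @Zorn_above _ P C; first by split=> // Y f.
  move=> F F0 FP totF; split; first by apply: chain_submodule => // S /FP[].
  move=> Y f fC m k A v Fv.
  have [S FS Sv] := chain_tuple F0 totF Fv.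
  exact: (FP _ FS).2.
have [e fe maxe] := maximal_endomorphism sD.
have rangeD : range e `<=` D.
  apply: maxD.
    by move=> d Dd; exists d => //; exact: fe.
  split; first exact: submodule_range.
  move=> Y f /essD fD m k A v ev sv.
  have [g gf] := reflecting_extends sD fD.
  have /choice[u uv] : forall i, exists u, e u = v i.
    by move=> i; have [u _ <-] := ev i; exists u.
  have gfe_fix : fixes D (g \o f \o e : {linear E -> E}).
    by move=> d Dd /=; rewrite fe //; exact: gf.
  have gfe_more : more_soluble e (g \o f \o e : {linear E -> E}).
    by move=> m' k' A' v' /(soluble_map f)/(soluble_map g).
  have : soluble A (fun i => g (f (e (u i)))).
    by apply: (soluble_map g); apply: soluble_ext sv => i; rewrite uv.
  move=> /(maxe _ gfe_fix gfe_more); apply: soluble_ext => i; exact: uv.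
exists e; split.
- by move=> x; apply/fe/rangeD; exists x.
- by move=> c /CD; exact: fe.
- move=> Y f /essD fD m k A v ev; apply: fD => i; exact: rangeD.
Qed.

End Hull.

(** The envelope is the hull of [M] in a pure-injective extension [E]. It is
    minimal because a pure-injective pure submodule is a direct summand, and a
    projection onto one containing [M] is injective on the hull. *)
Lemma pure_injective_envelope_exists (R : nzRingType) (M : lmodType R) :
  exists (E : lmodType R) (i : {linear M -> E}), pure_injective_envelope i.
Proof.
have [E [i [piE puri]]] := pure_injective_extension M.
have [e [ee fixe esse]] := hull_exists piE (submodule_range i).
have [K [j [injj ranj]]] := submod_exists (submodule_range e).
have ej k : e (j k) = j k.
  by have : range e (j k) by [rewrite -ranj; exists k]; move=> [x _ <-].
have /choice[r rE] : forall x, exists k, j k = e x.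
  by move=> x; have : range e (e x) by [exists x]; rewrite -ranj => -[k _ <-]; exists k.
have lin_r : linear r by move=> a x y; apply: injj; rewrite linearP !rE linearP.
have rj k : r (j k) = k by apply: injj; rewrite rE ej.
have jri m : j (r (i m)) = i m by rewrite rE fixe //; exists m.
exists K, (linear_pack lin_r \o i); split.
- move=> A N f g purf; have [h hf] := piE A N f (j \o g) purf.
  exists (linear_pack lin_r \o h) => x /=; have /= -> := hf x; exact: rj.
- apply/pure_embeddingP => m k A v _ sv.
  apply: pure_embedding_reflects puri _.
  by apply: soluble_ext (soluble_map j sv) => l /=.
- move=> E' i' s piE' puri' purs si'.
  have [t ts] := piE' _ _ s idfun purs.
  pose f : {linear E -> E} := j \o (s \o (t \o linear_pack lin_r)).
  have /esse/reflecting_inj f_inj : reflecting f (range i).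
    move=> m k A v iv; apply: soluble_ext => l; have [x _ <-] := iv l.
    rewrite /f /=; have /= <- := si' x; have /= -> := ts (i' x).
    by have /= -> := si' x.
  apply/seteqP; split=> // x _; exists (t x) => //.
  apply/eqP; rewrite -subr_eq0; apply/eqP; apply: injj.
  rewrite [RHS]linear0; apply: f_inj; first by rewrite -ranj; exists (s (t x) - x).
  rewrite /f /= rj linearB /=; have /= -> := ts (t x).
  by rewrite subrr !linear0.
Qed.

(** * Amalgamation of flat modules over elements of the same type *)

Section FlatEnvelopes.
Variable R : nzRingType.
Hypothesis envelope_flat : forall (M E : lmodType R) (i : {linear M -> E}),
  flat M -> pure_injective_envelope i -> flat E.

Lemma flat_pure_injective_extension (M : lmodType R) : flat M ->
  exists (E : lmodType R) (i : {linear M -> E}),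
    [/\ flat E, pure_injective E & pure_embedding i].
Proof.
move=> flM; have [E [i envi]] := pure_injective_envelope_exists M.
exists E, i; split; [exact: envelope_flat envi| |]; by case: envi.
Qed.

(** The first module is projected to the hull of the common part, on which the
    map to an extension of the second one is a pure embedding; the complement
    of the hull is kept apart in a second summand. *)
Lemma flat_amalgamation (N1 N2 : lmodType R) (G : set (N1 * N2)) :
    flat N1 -> flat N2 -> submodule G ->
    (forall m k (A : 'M[R]_(m, k)) v w, (forall i, G (v i, w i)) ->
      (soluble A v <-> soluble A w)) ->
  exists (N : lmodType R) (f1 : {linear N1 -> N}) (f2 : {linear N2 -> N}),
    [/\ flat N, pure_embedding f1, pure_embedding f2 &
        forall x y, G (x, y) -> f1 x = f2 y].
Proof.
move=> fl1 fl2 sG ppG.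
have [E1 [i1 [flE1 pi1 pur1]]] := flat_pure_injective_extension fl1.
have [E2 [i2 [flE2 pi2 pur2]]] := flat_pure_injective_extension fl2.
pose G' := [set p : E1 * E2 | exists x y, G (x, y) /\ p = (i1 x, i2 y)].
pose C := [set u : E1 | exists x y, G (x, y) /\ u = i1 x].
have sC : submodule C.
  apply/submoduleP; split.
    by exists 0, 0; split; [exact: submodule0 sG|rewrite linear0].
  move=> a _ _ [x [y [Gxy ->]]] [x' [y' [Gxy' ->]]]; exists (a *: x + x'), (a *: y + y').
  by split; [exact (submoduleD sG (submoduleZ sG a Gxy) Gxy')|rewrite linearP].
have [|h hG] := @pure_injective_extends R E1 E2 G' pi2.
  split.
    apply/submoduleP; split.
      by exists 0, 0; split; [exact: submodule0 sG|rewrite !linear0].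
    move=> a _ _ [x [y [Gxy ->]]] [x' [y' [Gxy' ->]]]; exists (a *: x + x'), (a *: y + y').
    by split; [exact (submoduleD sG (submoduleZ sG a Gxy) Gxy')|rewrite !linearP].
  move=> m k A v w /choice[x /choice[y xyP]] sv.
  have vx l : v l = i1 (x l) by case: (xyP l) => _ [].
  have wy l : w l = i2 (y l) by case: (xyP l) => _ [].
  have : soluble A x by apply: pure_embedding_reflects pur1 _; apply: soluble_ext sv.
  move=> /(ppG _ _ _ _ _ (fun l => (xyP l).1))/(soluble_map i2).
  by apply: soluble_ext => l; rewrite wy.
have [e [ee fixe esse]] := hull_exists pi1 sC.
have href : reflecting h (range e).
  apply: esse => m k A v /choice[x /choice[y xyP]] sv.
  have vx l : v l = i1 (x l) by case: (xyP l).
  have hv l : h (v l) = i2 (y l).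
    by apply: hG; exists (x l), (y l); split; [exact: (xyP l).1|rewrite vx].
  have : soluble A y by apply: pure_embedding_reflects pur2 _; apply: soluble_ext sv.
  move=> /(ppG _ _ _ _ _ (fun l => (xyP l).1))/(soluble_map i1).
  by apply: soluble_ext => l; rewrite vx.
have lin1 : linear (fun x : N1 => (h (e (i1 x)), i1 x - e (i1 x)) : E2 * E1).
  move=> a x y; congr pair => /=; first by rewrite !linearP.
  by rewrite !linearP scalerBr scalerN addrACA.
have lin2 : linear (fun y : N2 => (i2 y, 0) : E2 * E1).
  by move=> a x y; congr pair => /=; rewrite ?linearP // scaler0 addr0.
exists (E2 * E1)%type, (linear_pack lin1), (linear_pack lin2); split.
- exact: flat_prod.
- apply/pure_embeddingP => m k A v _ sv.
  apply: pure_embedding_reflects pur1 _.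
  have s1 : soluble A (fun l => e (i1 (v l))).
    apply: href => [l|]; first by exists (i1 (v l)).
    by have := soluble_map (fst : {linear (E2 * E1)%type -> E2}) sv.
  have := solubleD s1 (soluble_map (snd : {linear (E2 * E1)%type -> E1}) sv).
  by apply: soluble_ext => l /=; rewrite addrC subrK.
- apply/pure_embeddingP => m k A v _ sv; apply: pure_embedding_reflects pur2 _.
  by have := soluble_map (fst : {linear (E2 * E1)%type -> E2}) sv.
- move=> x y Gxy; have ex : e (i1 x) = i1 x by apply: fixe; exists x, y.
  rewrite /= ex subrr; congr pair; apply: hG; by exists x, y.
Qed.

End FlatEnvelopes.

(** * Cardinal arithmetic *)

(** Stated for types rather than sets, so as to include types in a higher
    universe, such as the type of all Galois types over a module. *)
Definition emb (A B : Type) : Prop := exists f : A -> B, injective f.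

Lemma emb_refl A : emb A A. Proof. by exists id. Qed.

Lemma emb_trans A B C : emb A B -> emb B C -> emb A C.
Proof. by move=> [f fi] [g gi]; exists (g \o f); exact: inj_comp. Qed.

Lemma card_leP_emb A B : ([set: A] #<= [set: B]) <-> emb A B.
Proof.
split=> [/card_leP[f]|[f fi]].
  have fi : injective f by move=> x y fxy; apply: (@inj _ _ _ f) => //; exact: mem_set.
  exists (fun a => sval (f (exist _ a (mem_set (I : [set: A] a))))) => x y.
  by move=> /val_inj/fi[].
apply/card_leP/injfunPex.
exists (fun a : [set: A] => SigSub (mem_set (I : [set: B] (f (val a)))) : [set: B]) => //.
by move=> x y _ _ /(congr1 val)/fi/val_inj.
Qed.

Lemma emb_prod A B A' B' : emb A A' -> emb B B' -> emb (A * B) (A' * B').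
Proof.
move=> [f fi] [g gi]; exists (fun p => (f p.1, g p.2)).
by move=> [a b] [c d] [/fi -> /gi ->].
Qed.

Lemma emb_sum A B A' B' : emb A A' -> emb B B' -> emb (A + B) (A' + B').
Proof.
move=> [f fi] [g gi].
exists (fun s => match s with inl a => inl (f a) | inr b => inr (g b) end).
by move=> [a|b] [c|d] // [] => [/fi|/gi] ->.
Qed.

Lemma emb_arrow A B B' : emb B B' -> emb (A -> B) (A -> B').
Proof.
move=> [f fi]; exists (fun g => f \o g) => g h gh.
by apply: functional_extensionality_dep => a; apply: fi; exact: (congr1 (@^~ a) gh).
Qed.

Lemma emb_left_inverse A B (f : A -> B) (a0 : A) : injective f ->
  exists g : B -> A, cancel f g.
Proof.
move=> fi; have /choice[g gE] : forall b, exists a, forall a', f a' = b -> a = a'.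
  move=> b; have [[a <-]|nex] := pselect (exists a, f a = b).
    by exists a => a' /fi.
  by exists a0 => a' fa'; case: nex; exists a'.
by exists g => a; exact: gE.
Qed.

Lemma emb_arrow_dom A A' B : B -> emb A A' -> emb (A -> B) (A' -> B).
Proof.
move=> b0 [f fi]; have [[a0]|noA] := pselect (inhabited A).
  have [g gK] := emb_left_inverse a0 fi.
  exists (fun h => h \o g) => h h' hh'; apply: functional_extensionality_dep => a.
  by have := congr1 (@^~ (f a)) hh'; rewrite /= gK.
exists (fun _ _ => b0) => h h' _; apply: functional_extensionality_dep => a.
by case: noA.
Qed.

Lemma emb_curry A B C : emb (A -> B -> C) (A * B -> C).
Proof.
exists (fun f p => f p.1 p.2) => f g fg; apply: functional_extensionality_dep => a.
by apply: functional_extensionality_dep => b; exact: (congr1 (@^~ (a, b)) fg).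
Qed.

Lemma emb_total A B : emb A B \/ emb B A.
Proof.
pose P := [set G : set (A * B) | forall p q, G p -> G q -> (p.1 = q.1 <-> p.2 = q.2)].
have [||G [_ PG maxG]] := @Zorn_above _ P set0; first by [].
  move=> F F0 FP totF p q [S FS Sp] [S' FS' Sq].
  by have [SS|SS] := totF _ _ FS FS'; [apply: (FP _ FS')|apply: (FP _ FS)] => //; exact: SS.
have [/choice[f fG]|/existsNP[a na]] := pselect (forall a, exists b, G (a, b)).
  by left; exists f => x y fxy; apply: (PG _ _ (fG x) (fG y)).2.
have [/choice[g gG]|/existsNP[b nb]] := pselect (forall b, exists a, G (a, b)).
  by right; exists g => x y gxy; apply: (PG _ _ (gG x) (gG y)).1.
exfalso; apply: (na); exists b; apply: (maxG (G `|` [set (a, b)])).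
- by move=> p Gp; left.
- move=> [x y] [x' y'] [Gp|[-> ->]] [Gq|[-> ->]] //=; first exact: (PG _ _ Gp Gq).
    by split=> E; [case: (na); exists y; rewrite -E|case: (nb); exists x; rewrite -E].
  by split=> E; [case: (na); exists y'; rewrite E|case: (nb); exists x'; rewrite E].
- by right.
Qed.

Lemma emb_subset (K : Type) (S S' : set K) : inhabited K ->
    emb {x | S x} {y | S' y} ->
  exists h : K -> K, (forall x, S x -> S' (h x)) /\
    forall x y, S x -> S y -> h x = h y -> x = y.
Proof.
move=> [k0] [g gi]; have /choice[h hE] : forall x, exists y, forall Sx : S x, y = sval (g (exist _ x Sx)).
  move=> x; have [Sx|nSx] := pselect (S x); last by exists k0 => Sx.
  by exists (sval (g (exist _ x Sx))) => Sx'; rewrite (Prop_irrelevance Sx Sx').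
exists h; split=> [x Sx|x y Sx Sy]; first by rewrite (hE x Sx); exact: svalP.
by rewrite (hE x Sx) (hE y Sy) => /eq_sig_hprop-/(_ (fun _ => @Prop_irrelevance _))/gi[].
Qed.

(** Hessenberg's theorem. An injection of [X * X] into [X] with [X] maximal is
    considered. If the complement of [X] embeds in [X], then [X] is as large
    as the whole set; otherwise the complement contains a copy of [X], in
    which there is room for the new pairs. *)
Lemma emb_square (K : Type) : emb nat K -> emb (K * K) K.
Proof.
move=> [n ni]; pose dom (G : set (K * K * K)) := [set x | exists k, G ((x, x), k)].
pose P := [set G : set (K * K * K) | [/\
  forall p q, G p -> G q -> (p.1 = q.1 <-> p.2 = q.2),
  forall x y k, G ((x, y), k) -> [/\ dom G x, dom G y & dom G k] &
  forall x y, dom G x -> dom G y -> exists k, G ((x, y), k)]].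
have natnat : emb (nat * nat) nat by exists pickle; exact: (pcan_inj pickleK).
have [c ci] := natnat.
pose G0 := [set p : K * K * K | exists i j, p = ((n i, n j), n (c (i, j)))].
have dom0 i : dom G0 (n i) by exists (n (c (i, i))), i, i.
have PG0 : P G0.
  split.
  - move=> _ _ [i [j ->]] [i' [j' ->]] /=; split=> [[/ni -> /ni ->] //|/ni/ci[-> ->] //].
  - by move=> x y k [i [j [-> -> ->]]]; split; exact: dom0.
  - by move=> x y [_ [i [_ [-> _ _]]]] [_ [j [_ [-> _ _]]]]; exists (n (c (i, j))), i, j.
have [||G [G0G [Ginj Gdom Gtot] maxG]] := @Zorn_above _ P G0; first exact: PG0.
  move=> F [S0 FS0] FP totF.
  have two (p q : K * K * K) : (\bigcup_(S in F) S) p -> (\bigcup_(S in F) S) q ->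
      exists S, [/\ F S, S p & S q].
    move=> [S FS Sp] [S' FS' Sq].
    by have [SS|SS] := totF _ _ FS FS'; [exists S'|exists S]; split=> //; exact: SS.
  split.
  - by move=> p q Fp Fq; have [S [/FP[+ _ _] Sp Sq]] := two _ _ Fp Fq; apply.
  - move=> x y k [S FS Sxyk]; have [_ + _] := FP _ FS => /(_ _ _ _ Sxyk)[[x' ?] [y' ?] [k' ?]].
    by split; [exists x', S|exists y', S|exists k', S].
  - move=> x y [x' Fx] [y' Fy]; have [S [FS Sx Sy]] := two _ _ Fx Fy.
    have [_ _ Stot] := FP _ FS.
    have [||k Sk] := Stot x y; [by exists x'|by exists y'|by exists k, S].
pose X := dom G.
have Xn i : X (n i) by exists (n (c (i, i))); apply: G0G; exists i, i.
have /choice[f fG] : forall p : K * K, exists k, X p.1 -> X p.2 -> G (p, k).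
  move=> [x y]; have [[Xx Xy]|nX] := pselect (X x /\ X y); last first.
    by exists (n 0) => Xx Xy; case: nX.
  by have [k Gk] := Gtot x y Xx Xy; exists k.
have fX x y : X x -> X y -> X (f (x, y)).
  by move=> Xx Xy; have [] := Gdom _ _ _ (fG (x, y) Xx Xy).
have finj x y x' y' : X x -> X y -> X x' -> X y' -> f (x, y) = f (x', y') ->
    x = x' /\ y = y'.
  move=> Xx Xy Xx' Xy' /(Ginj _ _ (fG (x, y) Xx Xy) (fG (x', y') Xx' Xy')).2.
  by move=> [].
have [/(emb_subset (inhabits (n 0)))[g [gX gi]]|/(emb_subset (inhabits (n 0)))[g [gX gi]]] :=
    emb_total {y | ~ X y} {x | X x}.
  pose h (k : K) : K := if pselect (X k) then f (n 0, k) else f (n 1, g k).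
  have hX k : X (h k) by rewrite /h; case: pselect => Xk; apply: fX => //; exact: gX.
  have hi : injective h.
    move=> k l; rewrite /h; case: pselect => Xk; case: pselect => Xl /finj[] //;
      try by [exact: gX | move=> /ni].
    by move=> _; apply: gi.
  exists (fun p => f (h p.1, h p.2)) => -[x y] [x' y'] /= /finj[] //.
  by move=> /hi -> /hi ->.
exfalso; pose Y := [set y | X y \/ exists2 x, X x & y = g x].
(* The retraction r of X and its copy onto X, together with the position of the
   two entries (tag), determines a pair. *)
have /choice[r rP] : forall y, exists x, [/\ Y y -> X x, X y -> x = y & forall z, X z -> y = g z -> x = z].
  move=> y; have [Xy|nXy] := pselect (X y).
    by exists y; split=> // z Xz yz; case: (gX z Xz); rewrite -yz.
  have [[x Xx ->]|nY] := pselect (exists2 x, X x & y = g x).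
    by exists x; split=> // [/(gX x Xx)//|z Xz /gi]; apply.
  by exists y; split=> [[|]||z Xz yz] //; case: nY; exists z.
have Yinj y y' : Y y -> Y y' -> (X y <-> X y') -> r y = r y' -> y = y'.
  move=> Yy Yy' XX; have [Xy|nXy] := pselect (X y).
    have [_ ry _] := rP y; have [_ ry' _] := rP y'.
    by rewrite ry // ry' //; exact/XX.
  case: Yy => [//|[z Xz yz]]; case: Yy' => [/XX//|[z' Xz' yz']].
  by have [_ _ /(_ z Xz yz) ->] := rP y; have [_ _ /(_ z' Xz' yz') ->] := rP y'; rewrite yz yz' => ->.
pose tag (y y' : K) : nat := if pselect (X y) then (if pselect (X y') then 0 else 1)%N
  else (if pselect (X y') then 2 else 3)%N.
pose code (y y' : K) := f (n (tag y y'), f (r y, r y')).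
have codeX y y' : Y y -> Y y' -> X (code y y').
  by move=> Yy Yy'; apply: (fX) => //; apply: (fX); [have [+ _ _] := rP y|have [+ _ _] := rP y']; apply.
pose New := [set p : K * K * K | exists y y', [/\ Y y, Y y', ~ (X y /\ X y') &
  p = ((y, y'), g (code y y'))]].
have YG y : Y y -> dom (G `|` New) y.
  move=> Yy; have [Xy|nXy] := pselect (X y).
    by have [k Gk] := Gtot y y Xy Xy; exists k; left.
  by exists (g (code y y)); right; exists y, y; split=> // -[].
have GY y : dom (G `|` New) y -> Y y.
  by move=> [k [Gk|[x [x' [Yx Yx' _ [-> _ _]]]]]] //; left; exists k.
suff PG : P (G `|` New).
  have Xg : Y (g (n 0)) by right; exists (n 0).
  have [k] := YG _ Xg; move=> /(maxG _ _ PG) Gk.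
  by apply: (gX (n 0)) => //; exists k; apply: Gk => q Gq; left.
split.
- move=> p q [Gp|[y [y' [Yy Yy' nX ->]]]] [Gq|[z [z' [Yz Yz' nX' ->]]]].
  + exact: Ginj.
  + case: p Gp => -[x x'] k Gp; have [Xx Xx' Xk] := Gdom _ _ _ Gp.
    split=> /= [[xz xz']|kg]; first by case: nX'; rewrite -xz -xz'.
    by case: (gX _ (codeX z z' Yz Yz')); rewrite -kg.
  + case: q Gq => -[x x'] k Gq; have [Xx Xx' Xk] := Gdom _ _ _ Gq.
    split=> /= [[xz xz']|kg]; first by case: nX; rewrite xz xz'.
    by case: (gX _ (codeX y y' Yy Yy')); rewrite kg.
  + split=> /= [[-> ->] //|/gi]; move=> /(_ (codeX _ _ Yy Yy') (codeX _ _ Yz Yz')).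
    have rX t : Y t -> X (r t) by move=> Yt; have [+ _ _] := rP t; apply.
    move=> /finj[]; do ?[exact: Xn|apply: (fX); exact: rX].
    move=> /ni tt /finj[]; do ?exact: rX.
    move=> ry ry'; have [XX XX'] : (X y <-> X z) /\ (X y' <-> X z').
      by move: tt; rewrite /tag; do 4 case: pselect => ? //=.
    by congr (_, _); exact: Yinj.
- move=> x y k [Gxyk|[z [z' [Yz Yz' _ [-> -> ->]]]]].
    have [Xx Xy Xk] := Gdom _ _ _ Gxyk.
    by split; apply: YG; left.
  by split; apply: YG => //; right; exists (code z z') => //; exact: codeX.
- move=> x y /GY Yx /GY Yy; have [[Xx Xy]|nX] := pselect (X x /\ X y).
    by have [k Gk] := Gtot x y Xx Xy; exists k; left.
  by exists (g (code x y)); right; exists x, y.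
Qed.

Lemma sval_inj (T : Type) (P : T -> Prop) : injective (@sval T P).
Proof.
by move=> [x Px] [y Py] /= xy; case: _ / xy Py => Py; rewrite (Prop_irrelevance Px Py).
Qed.

Lemma emb_bool_nat : emb bool nat.
Proof. by exists nat_of_bool => -[] []. Qed.

Section InfiniteType.
Variable K : Type.
Hypothesis natK : emb nat K.

Lemma emb_inhabited : inhabited K.
Proof. by have [n _] := natK; exact: (inhabits (n 0)). Qed.

Lemma emb_prodK A B : emb A K -> emb B K -> emb (A * B) K.
Proof. by move=> AK BK; apply: emb_trans (emb_prod AK BK) (emb_square natK). Qed.

Lemma emb_sumK A B : emb A K -> emb B K -> emb (A + B) K.
Proof.
move=> [f fi] [g gi]; have [n ni] := natK; apply: emb_trans (emb_square natK).
exists (fun s => match s with inl a => (n 0, f a) | inr b => (n 1, g b) end).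
by move=> [a|b] [c|d] // [] // => [/fi ->|/ni|/ni|/gi ->].
Qed.

Lemma emb_optionK A : emb A K -> emb (option A) K.
Proof.
move=> AK; apply: emb_trans (emb_sumK AK natK).
exists (fun o => if o is Some a then inl a else inr 0%N).
by move=> [a|] [b|] // [->].
Qed.

Lemma emb_seqK A : emb A K -> emb (seq A) K.
Proof.
move=> [f fi]; have [e ei] := emb_optionK (emb_square natK).
exists (foldr (fun x k => e (Some (f x, k))) (e None)).
elim=> [|x s IH] [|y t] //= /ei // [] /fi -> /IH ->; exact: erefl.
Qed.

(** Pairs are coded as tuples indexed by two elements of [K]. *)
Lemma emb_power_prod B : emb (K -> B) B -> emb (B * B) B.
Proof.
have [[n ni] [k0]] := (natK, emb_inhabited) => KB.
have [[b0]|noB] := pselect (inhabited B); last first.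
  by exists fst => -[b]; case: noB.
apply: emb_trans KB.
apply: (@emb_trans _ (bool -> B)).
  exists (fun p b => if b then p.1 else p.2) => -[x y] [x' y'] E.
  by congr (_, _); [exact: (congr1 (@^~ true) E)|exact: (congr1 (@^~ false) E)].
apply: emb_arrow_dom b0 _; apply: emb_trans natK; exact: emb_bool_nat.
Qed.

Lemma emb_power_self B : emb (K -> bool) B -> emb K B.
Proof.
apply: emb_trans; exists (fun k l => `[< k = l >]) => k l /(congr1 (@^~ l)) E.
by apply/asboolP; rewrite E; apply/asboolP.
Qed.

(** The case distinction on [lam] is needed here only. If [lam] has as many
    [K]-ary tuples as elements, then [lam] itself can be taken. Otherwise [B]
    consists of the [K]-ary tuples from the sum of [2 ^ K] and [S]; both are
    smaller than [lam], hence so are their sum and the set of tuples. *)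
Lemma segment_bound (lam S : Type) :
    emb nat lam ->
    emb (K -> lam) lam \/ (forall mu, ~ emb lam mu -> ~ emb lam (K -> mu)) ->
    ~ emb lam S ->
  exists B, [/\ emb (K -> B) B, emb (K -> bool) B, emb S B & emb B lam].
Proof.
move=> natL [powL|powL] nLS.
  exists lam; split=> //; last exact: emb_refl.
    apply: emb_trans powL; apply: emb_arrow; exact: emb_trans emb_bool_nat natL.
  by have [] := emb_total S lam.
have smallP : ~ emb lam (K -> bool).
  apply: powL => Lbool; have [] // := emb_trans natL Lbool => f fi.
  have := @fintype.leq_card 'I_3 bool (fun i => f i).
  by rewrite card_ord card_bool => /(_ (fun i j E => val_inj (fi _ _ E))).
have natP : emb nat (K -> bool) by apply: emb_trans natK _; exact/emb_power_self/emb_refl.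
pose mu : Type := ((K -> bool) + S)%type.
have small_mu : ~ emb lam mu.
  move=> Lmu; have [PS|SP] := emb_total (K -> bool) S.
    apply: nLS; apply: emb_trans Lmu _.
    have natS := emb_trans natP PS.
    apply: emb_trans (emb_sum PS (emb_refl S)) _.
    have [n ni] := natS; apply: emb_trans (emb_square natS).
    exists (fun s => match s with inl a => (n 0, a) | inr b => (n 1, b) end).
    by move=> [a|b] [c|d] // [] // => [->|/ni|/ni|->].
  apply: smallP; apply: emb_trans Lmu _.
  apply: emb_trans (emb_sum (emb_refl _) SP) _.
  have [n ni] := natP; apply: emb_trans (emb_square natP).
  exists (fun s => match s with inl a => (n 0, a) | inr b => (n 1, b) end).
  by move=> [a|b] [c|d] // [] // => [->|/ni|/ni|->].
have mu0 : mu := inl (fun=> true).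
have muK : emb mu (K -> mu).
  have [k0] := emb_inhabited.
  by exists (fun x _ => x) => x y /(congr1 (@^~ k0)).
exists (K -> mu); split.
- apply: emb_trans (@emb_curry K K mu) _; apply: emb_arrow_dom mu0 _; exact: emb_square.
- by apply: emb_trans muK; exists inl => x y [].
- by apply: emb_trans muK; exists inr => x y [].
- by have [//|/(powL _ small_mu)] := emb_total (K -> mu) lam.
Qed.

End InfiniteType.

(** An initial ordinal: if some initial segment of a well-order is as large as
    the whole, the order is transported from the least such segment. *)
Lemma initial_well_order (L : Type) : exists lt : L -> L -> Prop,
  [/\ forall a b c, lt a b -> lt b c -> lt a c,
      forall a b, [\/ lt a b, a = b | lt b a],
      forall S : set L, S !=set0 -> exists2 a, S a & forall b, S b -> ~ lt b a &
      forall a, ~ emb L {b | lt b a}].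
Proof.
have [le wo] := wochoice.well_ordering_principle {classic L}.
have minS (S : set L) : S !=set0 -> exists2 a : L, S a & forall b, S b -> le a b.
  move=> [x Sx]; have [|a [[Sa amin] _]] := wo (fun x : {classic L} => `[< S x >]).
    by exists x; exact/asboolP.
  by exists a => [|b Sb]; [exact/asboolP|apply: amin; exact/asboolP].
have refl (a : L) : le a a.
  by have [|b -> ->] := minS [set a]; first by exists a.
have anti (a b : L) : le a b -> le b a -> a = b.
  move=> ab ba; have [|z [_ uz]] := wo (fun x : {classic L} => `[< x = a \/ x = b >]).
    by exists a; apply/asboolP; left.
  have <- : z = a by apply: uz; split; [apply/asboolP; left|move=> x /asboolP[->|->]].
  by apply: uz; split; [apply/asboolP; right|move=> x /asboolP[->|->]].
have tot (a b : L) : le a b \/ le b a.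
  have [|m [->|->] mP] := minS [set x | x = a \/ x = b]; first by exists a; left.
    by left; apply: mP; right.
  by right; apply: mP; left.
have trans (a b c : L) : le a b -> le b c -> le a c.
  move=> ab bc; have [|m mabc mP] := minS [set x | [\/ x = a, x = b | x = c]].
    by exists a; constructor 1.
  have ma : le m a by apply: mP; constructor 1.
  have mb : le m b by apply: mP; constructor 2.
  have mc : le m c by apply: mP; constructor 3.
  case: mabc => E; rewrite {}E in ma mb mc => //.
    by rewrite (anti _ _ ab ma).
  by rewrite -(anti _ _ bc mb).
pose lt (a b : L) := le a b /\ a <> b.
have lt_trans a b c : lt a b -> lt b c -> lt a c.
  move=> [ab nab] [bc nbc]; split; first exact: trans bc.
  by move=> ac; apply: nbc; apply: anti => //; rewrite -ac.
have lt_tot a b : [\/ lt a b, a = b | lt b a].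
  have [ab|ab] := pselect (a = b); first by constructor 2.
  by have [le_ab|le_ba] := tot a b; [constructor 1|constructor 3; split=> // /esym].
have lt_min (S : set L) : S !=set0 -> exists2 a, S a & forall b, S b -> ~ lt b a.
  move=> /minS[a Sa aP]; exists a => // b Sb [ba]; apply; apply: anti => //; exact: aP.
have [[a0 La0]|small] := pselect (exists a, emb L {b | lt b a}); last first.
  by exists lt; split=> // a La; apply: small; exists a.
have [|a [f fi] amin] := lt_min [set a | emb L {b | lt b a}]; first by exists a0.
exists (fun x y => lt (sval (f x)) (sval (f y))); split.
- by move=> x y z; exact: lt_trans.
- move=> x y; have [xy|/sval_inj/fi ->|yx] := lt_tot (sval (f x)) (sval (f y)).
  + by constructor 1.
  + by constructor 2.
  + by constructor 3.
- move=> S [x Sx]; have [|b [y Sy <-] bP] := lt_min [set sval (f x) | x in S].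
    by exists (sval (f x)), x.
  by exists y => // z Sz; apply: bP; exists z.
- move=> y Ly; apply: (amin (sval (f y))); last exact: (proj2_sig (f y)).
  apply: emb_trans Ly _.
  exists (fun z : {x | lt (sval (f x)) (sval (f y))} =>
    exist (fun b => lt b (sval (f y))) (sval (f (sval z))) (proj2_sig z)) => z z' E.
  by apply: sval_inj; apply: fi; apply: sval_inj; exact: (congr1 sval E).
Qed.

(** * Small pure-injective summands *)

Section Closure.
Variables (R : nzRingType) (W : lmodType R).
Hypothesis piW : pure_injective W.

(** A code stands for the condition on an element [w] that [A y = v + w b] be
    soluble: it lists the dimensions and the entries of [A], and the entries of
    [b], but not [v]. Lists are used in place of matrices to make it evident
    that there are few codes. *)
Definition code : Type := (nat * nat * seq (seq R) * seq R)%type.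

Definition code_mx (c : code) : 'M[R]_(c.1.1.1, c.1.1.2) :=
  \matrix_(i, j) nth 0 (nth [::] c.1.2 i) j.

Definition code_vec (c : code) (i : nat) : R := nth 0 c.2 i.

Lemma code_exists m k (A : 'M[R]_(m, k)) (b : 'I_m -> R) : exists s t,
  code_mx (m, k, s, t) = A /\ forall i : 'I_m, code_vec (m, k, s, t) i = b i.
Proof.
exists [seq [seq A i j | j <- enum 'I_k] | i <- enum 'I_m], [seq b i | i <- enum 'I_m].
split=> [|i].
  apply/matrixP => i j; rewrite mxE /= (nth_map i) ?size_enum_ord // nth_ord_enum.
  by rewrite (nth_map j) ?size_enum_ord // nth_ord_enum.
by rewrite /code_vec /= (nth_map i) ?size_enum_ord // nth_ord_enum.
Qed.

Definition solves (l : code -> bool) (f : code -> nat -> W) (w : W) : Prop :=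
  forall c, l c -> soluble (code_mx c) (fun i => f c i + code_vec c i *: w).

(** Partial homomorphisms are extended one element at a time, and a new element
    is subject to one condition for each code. It is therefore enough for
    pure-injectivity to solve the sets of conditions of this size, and the
    closure remains small. The value 0 stands for a missing solution. *)
Inductive sol_closure (X : set W) : W -> Prop :=
| closure_gen x : X x -> sol_closure X x
| closure0 : sol_closure X 0
| closure_lin a u v : sol_closure X u -> sol_closure X v -> sol_closure X (a *: u + v)
| closure_sol l f : (forall c i, sol_closure X (f c i)) -> sol_closure X (xget 0 (solves l f)).

Lemma closure_submodule X : submodule (sol_closure X).
Proof. by apply/submoduleP; split=> [|a u v]; [exact: closure0|exact: closure_lin]. Qed.

Lemma closure_mono X Y : X `<=` Y -> sol_closure X `<=` sol_closure Y.
Proof.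
move=> XY x; elim=> {x} [x /XY|||] //; [exact: closure_gen|exact: closure0| |].
  by move=> a u v _ ? _ ?; exact: closure_lin.
by move=> l f _ ?; exact: closure_sol.
Qed.

(** One more element [y] only adds one system for each code: any two systems
    with the same code differ by a system over the elements already treated. *)
Lemma closure_extends (X : set W) (Y : lmodType R) (G : set (Y * W)) :
    pp_graph G -> (forall y w, G (y, w) -> sol_closure X w) ->
  exists h : {linear Y -> W}, (forall y, sol_closure X (h y)) /\
    forall y w, G (y, w) -> h y = w.
Proof.
move=> ppG clG.
pose P := [set G : set (Y * W) | pp_graph G /\ forall y w, G (y, w) -> sol_closure X w].
have [||H [GH [[sH ppH] clH] maxH]] := @Zorn_above _ P G; first by [].
  move=> F F0 FP totF; split; last first.
    by move=> y w [S FS]; exact: (FP _ FS).2.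
  split; first by apply: chain_submodule => // S /FP[[]].
  move=> m k A v w Fvw.
  have [S FS Svw] := chain_tuple F0 totF Fvw.
  exact: (FP _ FS).1.2 Svw.
have tot y : exists w, H (y, w).
  pose good (c : code) (p : (nat -> Y) * (nat -> W)) :=
    [/\ forall i, sol_closure X (p.2 i), forall i : 'I_c.1.1.1, H (p.1 i, p.2 i) &
      soluble (code_mx c) (fun i => p.1 i + code_vec c i *: y)].
  pose l (c : code) : bool := `[< exists p, good c p >].
  have /choice[f fP] : forall c, exists p : (nat -> Y) * (nat -> W),
      (forall i, sol_closure X (p.2 i)) /\ (l c -> good c p).
    move=> c; have [[p pc]|nc] := pselect (exists p, good c p).
      by exists p; split=> //; case: pc.
    by exists (fun=> 0, fun=> 0); split=> [i|/asboolP //]; exact: closure0.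
  pose g c i := (f c).2 i.
  have [h0 h0H] := pure_injective_extends piW (conj sH ppH).
  have h0y : solves l g (h0 y).
    move=> c /(fP c).2[_ Hc sc]; apply: soluble_ext (soluble_map h0 sc) => i.
    by rewrite linearD linearZ /= (h0H _ _ (Hc i)).
  pose e := xget 0 (solves l g).
  have eP : solves l g e by exact: (xgetI _ h0y).
  have cle : sol_closure X e by apply: closure_sol => c i; exact: (fP c).1.
  pose H' := [set p : Y * W | exists q a, H q /\ p = (q.1 + a *: y, q.2 + a *: e)].
  exists e; apply: (maxH H'); last 1 first.
  - exists 0, 1; rewrite !scale1r; split; [exact: submodule0|by rewrite !add0r].
  - by move=> [u w] Huw; exists (u, w), 0; rewrite !scale0r !addr0.
  split; last first.
    move=> u w [q [a [Hq [_ ->]]]].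
    apply: (submoduleD (closure_submodule X)); first by apply: (clH q.1); case: (q) Hq.
    exact: (submoduleZ (closure_submodule X)).
  split.
    apply/submoduleP; split.
      by exists 0, 0; rewrite !scale0r !addr0; split=> //; exact: submodule0.
    move=> a _ _ [p [b [Hp ->]]] [q [c [Hq ->]]]; exists (a *: p + q), (a * b + c).
    split; first exact (submoduleD sH (submoduleZ sH a Hp) Hq).
    by congr pair; rewrite /= scalerDr scalerDl scalerA addrACA.
  move=> m k A v w /choice[q /choice[a qaP]] sv.
  have [s [t [AE bE]]] := code_exists A a.
  pose c : code := (m, k, s, t).
  have vE i : v i = (q i).1 + code_vec c i *: y by rewrite bE; case: (qaP i) => _ [].
  have wE i : w i = (q i).2 + code_vec c i *: e by rewrite bE; case: (qaP i) => _ [].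
  have lc : l c.
    pose ext (T : lmodType R) (u : 'I_m -> T) (i : nat) : T := if insub i is Some j then u j else 0.
    have extE T u (i : 'I_m) : ext T u i = u i by rewrite /ext valK.
    have Hq i : H ((q i).1, (q i).2) by case: (qaP i); case: (q i).
    apply/asboolP; exists (ext _ (fun i => (q i).1), ext _ (fun i => (q i).2)); split=> [i|i|] /=.
    - by rewrite /ext; case: insubP => [j _ _|_]; [exact: clH (Hq j)|exact: closure0].
    - by rewrite !extE.
    - by rewrite AE; apply: soluble_ext sv => i; rewrite vE extE.
  have [_ Hc sc] := (fP c).2 lc; rewrite /= AE in Hc sc.
  have := eP c lc; rewrite AE => se.
  have sd : soluble A (fun i => (q i).1 - (f c).1 i).
    apply: soluble_ext (solubleB sv sc) => i.
    by rewrite vE /= opprD addrACA subrr addr0.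
  have sdw : soluble A (fun i => (q i).2 - g c i).
    apply: ppH sd => i.
    have Hq : H ((q i).1, (q i).2) by case: (qaP i); case: (q i).
    exact (submoduleB sH Hq (Hc i)).
  apply: soluble_ext (solubleD sdw se) => i.
  by rewrite wE addrA subrK.
have H0 w : H (0, w) -> w = 0.
  move=> H0w; apply/soluble0; apply: (ppH _ _ _ (fun=> 0)) => //; exact/soluble0.
have [h hH] := linear_of_graph sH H0 tot.
exists h; split=> [y|y w /GH Hyw]; first exact: clH (hH y).
apply/eqP; rewrite -subr_eq0; apply/eqP/H0.
by have := submoduleB sH (hH y) Hyw; rewrite -[X in H X]/(_, _) /= subrr.
Qed.

(** As a partial homomorphism on [W] with values in the closure, the identity of
    the closure extends to a projection. *)
Lemma closure_retraction X : exists r : {linear W -> W},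
  (forall w, sol_closure X (r w)) /\ (forall w, sol_closure X w -> r w = w).
Proof.
pose G := [set p : W * W | sol_closure X p.1 /\ p.2 = p.1].
have [||r [rX rG]] := @closure_extends X W G.
- split.
    apply/submoduleP; split; first by split=> //; exact: closure0.
    move=> a p q [Xp p1] [Xq q1]; split; first exact: closure_lin.
    by rewrite -[LHS]/(a *: p.2 + q.2) p1 q1.
  by move=> m k A v w Gvw; apply: soluble_ext => i; case: (Gvw i) => _ /= ->.
- by move=> y w [Xy /= ->].
by exists r; split=> // w Xw; exact: rG.
Qed.

Lemma closure_pure X : pure_in (sol_closure X).
Proof.
have [r [rX rfix]] := closure_retraction X => m k A v Xv [y yv].
exists (fun j => r (y j)) => [j|i]; first exact: rX.
rewrite -(rfix _ (Xv i)) -yv linear_sum.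
by apply: eq_bigr => j _; rewrite linearZ.
Qed.

(** Elements of the closure are values of well-founded trees with nodes of
    arity at most the cardinality of [R + nat]. *)
Inductive tree (B : Type) : Type :=
| Leaf of B
| Zero
| Lin of R & tree B & tree B
| Sol of (code -> bool) & (code -> nat -> tree B).

Fixpoint eval (B : Type) (g : B -> W) (t : tree B) : W :=
  match t with
  | Leaf b => g b
  | Zero => 0
  | Lin a t u => a *: eval g t + eval g u
  | Sol l f => xget 0 (solves l (fun c i => eval g (f c i)))
  end.

Lemma emb_tree B (E : B + unit + R * (B * B) + (code -> bool) * (code * nat -> B) -> B) :
  injective E -> emb (tree B) B.
Proof.
move=> Ei; pose fix enc (t : tree B) : B :=
  match t with
  | Leaf b => E (inl (inl (inl b)))
  | Zero => E (inl (inl (inr tt)))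
  | Lin a t u => E (inl (inr (a, (enc t, enc u))))
  | Sol l f => E (inr (l, fun p => enc (f p.1 p.2)))
  end.
exists enc; elim=> [b||a t IHt u IHu|l f IHf] [b'||a' t' u'|l' f'] /= /Ei // [].
- by move=> ->.
- by move=> -> /IHt -> /IHu ->.
- move=> -> ff; congr Sol; apply: functional_extensionality_dep => c.
  apply: functional_extensionality_dep => i; apply: IHf.
  exact: (congr1 (fun h => h (c, i)) ff).
Qed.

End Closure.

Definition covers (B T : Type) (S : set T) : Prop :=
  exists g : B -> T, forall x, S x -> exists b, g b = x.

Lemma covers_emb (B B' T : Type) (S : set T) : T -> emb B B' -> covers B S -> covers B' S.
Proof.
move=> t0 [f fi] [g gS]; have /choice[h hE] : forall b', exists t, forall b, f b = b' -> g b = t.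
  move=> b'; have [[b <-]|nb] := pselect (exists b, f b = b').
    by exists (g b) => b1 /fi ->.
  by exists t0 => b fb; case: nb; exists b.
by exists h => x /gS[b <-]; exists (f b); rewrite -(hE (f b) b).
Qed.

Lemma covers_subtype (B T : Type) (S : set T) : covers B S -> emb {x | S x} B.
Proof.
move=> [g gS]; have /choice[h hE] : forall x : {x | S x}, exists b, g b = sval x.
  by move=> [x Sx]; exact: gS.
by exists h => x y hxy; apply: sval_inj; rewrite -!hE hxy.
Qed.

Lemma emb_nat_sum (A : Type) : emb nat (A + nat).
Proof. by exists inr => x y []. Qed.

Section ClosureSize.
Variables (R : nzRingType).
Local Notation K := (R + nat)%type.

Let natK : emb nat K := @emb_nat_sum R.

Lemma emb_code : emb (code R) K.
Proof.
have RK : emb R K by exists inl => x y [].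
have sK := emb_seqK natK.
by apply: emb_prodK (sK _ RK) => //; apply: emb_prodK (sK _ (sK _ RK)) => //; apply: emb_prodK.
Qed.

Lemma closure_covers (W : lmodType R) (X : set W) (B : Type) :
  emb (K -> B) B -> emb (K -> bool) B -> covers B X -> covers B (sol_closure X).
Proof.
move=> KB PB coverX.
have KB1 : emb K B by exact: emb_power_self PB.
have natB : emb nat B := emb_trans natK KB1.
have BB := emb_power_prod natK KB.
have [b0] := emb_inhabited natB.
have [E Ei] : emb (B + unit + R * (B * B) + (code R -> bool) * (code R * nat -> B)) B.
  apply: emb_sumK => //; first apply: emb_sumK => //; first apply: emb_sumK => //.
  - exact: emb_refl.
  - by apply: emb_trans natB; exists (fun=> 0%N) => -[] [].
  - apply: emb_prodK => //; apply: emb_trans KB1; by exists inl => x y [].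
  - apply: emb_prodK => //.
      apply: emb_trans PB; apply: emb_arrow_dom true _; exact: emb_code.
    apply: emb_trans KB; apply: emb_arrow_dom b0 _.
    apply: emb_prodK => //; exact: emb_code.
apply: covers_emb (emb_tree Ei) _; first exact: 0.
have [g gX] := coverX; exists (eval g) => x; elim=> {x} [x /gX[b <-]|||].
- by exists (Leaf R b).
- by exists (Zero R B).
- by move=> a u v _ [t <-] _ [s <-]; exists (Lin a t s).
- move=> l f _ fE; have /choice[t tE] : forall p : code R * nat, exists t, eval g t = f p.1 p.2.
    by move=> p; exact: fE.
  exists (Sol l (fun c i => t (c, i))); rewrite /=; congr xget; congr solves.
  by apply: functional_extensionality_dep => c; apply: functional_extensionality_dep => i; rewrite tE.
Qed.

End ClosureSize.

(** * Stability *)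

Section Stability.
Variable R : nzRingType.
Hypothesis envelope_flat : forall (M E : lmodType R) (i : {linear M -> E}),
  flat M -> pure_injective_envelope i -> flat E.
Local Notation K := (R + nat)%type.

Lemma pure_embedding_id (M : lmodType R) : pure_embedding (idfun : {linear M -> M}).
Proof. by apply/pure_embeddingP => m k A v _. Qed.

Section OverModel.
Variable M : lmodType R.
Local Notation triple := (gtriple R unit M).

Definition in_type (t : triple) m k (A : 'M[R]_(m, k)) (b : 'I_m -> R) (v : 'I_m -> M) : Prop :=
  soluble A (fun i => gt_base t (v i) + b i *: gt_seq t tt).

Lemma E_at_refl (t : triple) : E_at t t.
Proof.
exists (gt_model t), idfun, idfun; split=> //; [exact: gt_flat| |]; exact: pure_embedding_id.
Qed.

Lemma E_at_sym (t t' : triple) : E_at t t' -> E_at t' t.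
Proof. by move=> [N [f [g [flN pf pg fgb fgs]]]]; exists N, g, f; split=> // x; rewrite ?fgb ?fgs. Qed.

Lemma E_at_in_type (t t' : triple) m k (A : 'M[R]_(m, k)) b v :
  E_at t t' -> in_type t A b v -> in_type t' A b v.
Proof.
move=> [N [f [g [_ _ pg fgb fgs]]]] /(soluble_map f) sv.
apply: pure_embedding_reflects pg _; apply: soluble_ext sv => i.
by rewrite !linearD !linearZ /=; have /= -> := fgb (v i); have /= -> := fgs tt.
Qed.

Lemma gtp_in_type (t t' : triple) m k (A : 'M[R]_(m, k)) b v :
  gtp t = gtp t' -> in_type t A b v -> in_type t' A b v.
Proof.
move=> tt'; have : gtp t t' by rewrite tt'; exact/t_step/E_at_refl.
by elim=> [x y|x y z _ IH _ IH'] //; [exact: E_at_in_type|move=> /IH/IH'].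
Qed.

Lemma E_at_gtp (t t' : triple) : E_at t t' -> gtp t = gtp t'.
Proof.
move=> tt'; apply/funext => u; apply/propext; split; apply: t_trans; apply: t_step => //.
exact: E_at_sym.
Qed.

(** The two modules are amalgamated over the submodules generated by [M] and
    the realizations of the type. *)
Lemma same_type_E_at (t t' : triple) (i : {linear M -> gt_model t})
    (i' : {linear M -> gt_model t'}) :
    gt_base t =1 i -> gt_base t' =1 i' ->
    (forall m k (A : 'M[R]_(m, k)) b v, in_type t A b v <-> in_type t' A b v) ->
  E_at t t'.
Proof.
move=> bi bi' same.
pose G := [set p : gt_model t * gt_model t' | exists v a,
  p = (i v + a *: gt_seq t tt, i' v + a *: gt_seq t' tt)].
have [||N [f [g [flN pf pg fg]]]] :=
  flat_amalgamation envelope_flat (@gt_flat _ _ _ t) (@gt_flat _ _ _ t') (G := G).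
- apply/submoduleP; split; first by exists 0, 0; rewrite !linear0 !scale0r !addr0.
  move=> c _ _ [v [a ->]] [w [b ->]]; exists (c *: v + w), (c * a + b).
  by congr pair; rewrite /= linearP scalerDr scalerDl scalerA addrACA.
- move=> m k A x y /choice[v /choice[a xyE]]; have := same m k A a v.
  have xE l : x l = gt_base t (v l) + a l *: gt_seq t tt by rewrite bi; case: (xyE l).
  have yE l : y l = gt_base t' (v l) + a l *: gt_seq t' tt by rewrite bi'; case: (xyE l).
  by move=> [tt' t't]; split=> [sx|sy];
    [apply: soluble_ext (tt' _)|apply: soluble_ext (t't _)]; rewrite /in_type //;
    apply: soluble_ext sx || apply: soluble_ext sy.
exists N, f, g; split=> // x /=; apply: fg.
  by exists x, 0; rewrite !scale0r !addr0 bi bi'.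
by exists 0, 1; rewrite !scale1r !linear0 !add0r; case: x.
Qed.

(** A type over [M] is determined by the choice, for each code that it
    contains with some parameters in [M], of one tuple of such parameters. *)
Lemma gS_emb : emb (gS M) (code R -> nat -> option M).
Proof.
pose fact (p : gS M) (c : code R) (v : nat -> M) : Prop := exists t : triple,
  [/\ exists2 i : {linear M -> gt_model t}, pure_embedding i & gt_base t =1 i,
      sval p = gtp t & in_type t (code_mx c) (fun i => code_vec c i) (fun i => v i)].
have selP p : exists s : code R -> nat -> option M, forall c,
    (exists v, fact p c v /\ s c = fun n => Some (v n)) \/
    ((forall v, ~ fact p c v) /\ s c = fun=> None).
  have /choice[s sP] : forall c, exists s : nat -> option M,
    (exists v, fact p c v /\ s = fun n => Some (v n)) \/
    ((forall v, ~ fact p c v) /\ s = fun=> None).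
    move=> c; have [[v pv]|np] := pselect (exists v, fact p c v).
      by exists (fun n => Some (v n)); left; exists v.
    by exists (fun=> None); right; split=> // v pv; apply: np; exists v.
  by exists s.
exists (fun p => sval (cid (selP p))) => p q.
case: cid => /= s sp; case: cid => /= s' sq ss'; rewrite -{}ss' {s'} in sq.
have [t [[i puri bi] pt]] := svalP p; have [t' [[i' puri' bi'] qt]] := svalP q.
apply: sval_inj; rewrite pt qt; apply/E_at_gtp/(same_type_E_at bi bi').
(* Two sets of parameters for the same code differ by a soluble system over M. *)
have transfer (p1 p2 : gS M) (t1 t2 : triple) (i1 : {linear M -> gt_model t1})
    (i2 : {linear M -> gt_model t2}) :
    pure_embedding i1 -> pure_embedding i2 -> gt_base t1 =1 i1 -> gt_base t2 =1 i2 ->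
    sval p1 = gtp t1 -> sval p2 = gtp t2 ->
    (forall c, (exists v, fact p1 c v /\ s c = fun n => Some (v n)) \/
      ((forall v, ~ fact p1 c v) /\ s c = fun=> None)) ->
    (forall c, (exists v, fact p2 c v /\ s c = fun n => Some (v n)) \/
      ((forall v, ~ fact p2 c v) /\ s c = fun=> None)) ->
    forall m k (A : 'M[R]_(m, k)) b v, in_type t1 A b v -> in_type t2 A b v.
  move=> pur1 pur2 b1 b2 p1t p2t s1 s2 m k A b v t1v.
  have [e [f [AE bE]]] := code_exists A b; pose c : code R := (m, k, e, f).
  have in_code (t0 : triple) v' : in_type t0 (code_mx c) (fun i => code_vec c i) v' <-> in_type t0 A b v'.
    rewrite /in_type AE; split; apply: soluble_ext => l; by rewrite bE.
  have [[v1 [[u1 [_ p1u pu1]] sv1]]|[nv1 _]] := s1 c; last first.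
    case: (nv1 (fun n => if insub n is Some l then v l else 0)); exists t1; split=> //; first by exists i1.
    apply/in_code; apply: soluble_ext t1v => l.
    by rewrite valK.
  have [[v2 [[u2 [_ p2u pu2]] sv2]]|[_ sv2]] := s2 c; last first.
    by have := congr1 (@^~ 0%N) sv2; rewrite sv1.
  have v12 : v1 = v2.
    apply/funext => n; have := congr1 (@^~ n) sv2; rewrite sv1.
    by move=> [].
  have {}pu1 : in_type t1 A b (fun l => v1 l).
    by apply/in_code; apply: gtp_in_type pu1; rewrite -p1u.
  have {}pu2 : in_type t2 A b (fun l => v1 l).
    by rewrite v12; apply/in_code; apply: gtp_in_type pu2; rewrite -p2u.
  have : soluble A (fun l => v l - v1 l).
    apply: pure_embedding_reflects pur1 _; apply: soluble_ext (solubleB t1v pu1) => l.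
    by rewrite !b1 linearB opprD addrACA subrr addr0.
  move=> /(soluble_map i2)/solubleD/(_ pu2); apply: soluble_ext => l.
  by rewrite !b2 linearB /= addrA subrK.
by move=> m k A b v; split; [exact: (transfer p q _ _ i i')|exact: (transfer q p _ _ i' i)].
Qed.

End OverModel.

Lemma stable_of_power (lam : Type) :
  emb nat lam -> emb (K -> lam) lam -> stable R lam.
Proof.
move=> natL powL M flM cardM.
have ML : emb M lam by apply/card_leP_emb; have /card_eqPle[] := cardM.
have [l0] := emb_inhabited natL.
apply: emb_trans (gS_emb M) _; apply: emb_trans powL.
apply: emb_trans (@emb_curry _ _ _) _.
apply: emb_trans (emb_arrow _ (emb_optionK natL ML)) _.
apply: emb_arrow_dom l0 _; apply: emb_prodK; [exact: emb_nat_sum|exact: emb_code|exact: emb_nat_sum].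
Qed.

End Stability.

(** * Small pure submodules *)

Section SmallPure.
Variables (R : nzRingType) (Q : lmodType R) (x : Q).
Local Notation K := (R + nat)%type.

(** A term denotes a list of elements; only its head matters, except when it
    is the list of parameters of a system of equations. *)
Inductive term : Type :=
| TGen
| TNil
| TCons of term & term
| TLin of R & term & term
| TSol of code R & nat & term.

Definition system_sol (c : code R) (s : seq Q) : set (nat -> Q) :=
  [set y | forall i, \sum_j code_mx c i j *: y j = nth 0 s i].

Fixpoint term_val (t : term) : seq Q :=
  match t with
  | TGen => [:: x]
  | TNil => [::]
  | TCons t u => head 0 (term_val t) :: term_val u
  | TLin a t u => [:: a *: head 0 (term_val t) + head 0 (term_val u)]
  | TSol c j t => [:: xget (fun=> 0 : Q) (system_sol c (term_val t)) j]
  end.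

Lemma emb_term : emb term K.
Proof.
have natK : emb nat K := emb_nat_sum R.
have RK : emb R K by exists inl => a b [].
have uK : emb unit K by apply: emb_trans natK; exists (fun=> 0%N) => -[] [].
have [E Ei] : emb (unit + unit + K * K + R * (K * K) + (code R * nat) * K) K.
  have KK := emb_square natK; have cK := emb_code R.
  by do ?[exact: emb_refl|exact: emb_prodK|apply: emb_sumK|apply: emb_prodK].
pose fix enc (t : term) : K :=
  match t with
  | TGen => E (inl (inl (inl (inl tt))))
  | TNil => E (inl (inl (inl (inr tt))))
  | TCons t u => E (inl (inl (inr (enc t, enc u))))
  | TLin a t u => E (inl (inr (a, (enc t, enc u))))
  | TSol c j t => E (inr ((c, j), enc t))
  end.
exists enc; elim=> [||t IHt u IHu|a t IHt u IHu|c j t IHt] [||t' u'|a' t' u'|c' j' t'] //= /Ei // [].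
- by move=> /IHt -> /IHu ->.
- by move=> -> /IHt -> /IHu ->.
- by move=> -> -> /IHt ->.
Qed.

(** The downward Loewenheim-Skolem argument: the values of terms are closed
    under the choice of solutions of finite systems. *)
Lemma small_pure_submodule :
  exists P : set Q, [/\ submodule P, pure_in P, P x & covers K P].
Proof.
pose P := [set y | exists t, y = head 0 (term_val t)].
have tuple_val m (v : 'I_m -> Q) : (forall i, P (v i)) ->
    exists t, forall i : 'I_m, nth 0 (term_val t) i = v i.
  elim: m v => [|m IH] v Pv; first by exists TNil => -[].
  have [t tv] := IH _ (fun i => Pv (fintype.lift ord0 i)); have [u uv] := Pv ord0.
  exists (TCons u t) => i; case: (unliftP ord0 i) => [j ->|->] //=.
  exact: tv.
exists P; split.
- apply/submoduleP; split; first by exists TNil.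
  by move=> a _ _ [t ->] [u ->]; exists (TLin a t u).
- move=> m k A v /tuple_val[t tv] [y yv].
  have [s [s' [AE _]]] := code_exists A (fun=> 0).
  pose c : code R := (m, k, s, s').
  have sol : system_sol c (term_val t) (xget (fun=> 0 : Q) (system_sol c (term_val t))).
    have y_sol : system_sol c (term_val t) (fun j => if insub j is Some j then y j else 0).
      by move=> i; rewrite tv -yv AE; apply: eq_bigr => j _; rewrite valK.
    exact: (xgetI _ y_sol).
  exists (fun j => xget (fun=> 0 : Q) (system_sol c (term_val t)) j) => [j|i].
    by exists (TSol c j t).
  by rewrite -tv -sol -AE.
- by exists TGen.
- apply: covers_emb emb_term _; first exact: 0.
  by exists (fun t => head 0 (term_val t)) => y [t ->]; exists t.
Qed.

End SmallPure.

(** * A pure-injective module containing all small flat modules *)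

Lemma pure_embedding_retract (R : nzRingType) (X Y : lmodType R) (j : {linear X -> Y})
    (r : {linear Y -> X}) : cancel j r -> pure_embedding j.
Proof.
move=> jr; apply/pure_embeddingP => m k A v _ /(soluble_map r).
by apply: soluble_ext => i; exact: jr.
Qed.

Lemma pure_embedding_factor (R : nzRingType) (X Y Z : lmodType R) (f : {linear X -> Y})
    (g : {linear Y -> Z}) : pure_embedding (g \o f) -> pure_embedding f.
Proof.
move=> pgf; apply/pure_embeddingP => m k A v _ /(soluble_map g).
exact: pure_embedding_reflects pgf.
Qed.

Lemma linear_lift (R : nzRingType) (X Y Z : lmodType R) (f : {linear X -> Z})
    (j : {linear Y -> Z}) : injective j -> (forall x, range j (f x)) ->
  exists h : {linear X -> Y}, forall x, j (h x) = f x.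
Proof.
move=> injj fj; have /choice[h hE] : forall x, exists y, j y = f x.
  by move=> x; have [y _ <-] := fj x; exists y.
have lin_h : linear h by move=> a x y; apply: injj; rewrite linearP !hE linearP.
by exists (linear_pack lin_h).
Qed.

Lemma flat_regular (R : nzRingType) : flat (R^o : lmodType R).
Proof.
apply/flatP => n r x rx; exists 1%N, (\col_i x i), (fun=> 1); split=> [i|j].
  by rewrite big_ord1 mxE; exact: (esym (mulr1 (x i : R))).
by rewrite -[RHS]rx; apply: eq_bigr => i _; rewrite mxE.
Qed.

Section Universal.
Variable R : nzRingType.
Hypothesis envelope_flat : forall (M E : lmodType R) (i : {linear M -> E}),
  flat M -> pure_injective_envelope i -> flat E.
Local Notation K := (R + nat)%type.

Let natK : emb nat K := emb_nat_sum R.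

(** The closure inherits pure-injectivity from [W] as a retract. *)
Lemma closure_module (W : lmodType R) (X : set W) :
    flat W -> pure_injective W ->
  exists (G : lmodType R) (j : {linear G -> W}),
    [/\ flat G, pure_injective G, pure_embedding j & range j = sol_closure X].
Proof.
move=> flW piW; have [G [j [injj ranj]]] := submod_exists (closure_submodule X).
have purj : pure_embedding j.
  by apply: pure_in_embedding => //; rewrite ranj; exact: closure_pure.
have [r [rX rfix]] := closure_retraction piW X.
have [|s sE] := @linear_lift _ _ _ _ r j injj; first by move=> x; rewrite ranj.
have sj x : s (j x) = x.
  by apply: injj; rewrite sE rfix // -ranj; exists x.
exists G, j; split=> //; first exact: flat_pure purj flW.
move=> A N f g purf; have [h hf] := piW _ _ f (j \o g) purf.
by exists (s \o h) => x /=; have /= -> := hf x.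
Qed.

(** Up to isomorphism, the small flat modules are the flat quotients of one free
    module [V]. The closure of their direct sum in a flat pure-injective
    extension is small enough, since [V] has at most [2 ^ K] subsets. *)
Lemma small_flat_container : exists G : lmodType R,
  [/\ flat G, pure_injective G, emb G (K -> bool), (exists g : G, g <> 0) &
    forall F : lmodType R, flat F -> emb F K ->
      exists f : {linear F -> G}, pure_embedding f].
Proof.
pose Kc : choiceType := (R + nat)%type.
pose V : lmodType R := {freeg Kc / R}.
pose I := {S : set V & {sS : submodule S | flat (quotmod sS)}}.
pose H (i : I) : lmodType R := quotmod (sval (projT2 i)).
have [Z [inc [prj [prj_inc prj_off gen]]]] := direct_sum_exists H.
have flZ : flat Z by apply: flat_direct_sum gen _ => i; exact: (svalP (projT2 i)).
have [W [th [flW piW purth]]] := flat_pure_injective_extension envelope_flat flZ.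
pose gen_at (i : I) (k : Kc) : W := th (inc i (quot_proj (sval (projT2 i)) << k >>)).
pose X := [set w | exists i k, w = gen_at i k].
have cl_inc i u : sol_closure X (th (inc i u)).
  have [v <-] := quot_proj_surj u; rewrite -(freeg_sumE v) !linear_sum.
  apply: (submodule_sum (closure_submodule X)) => k.
  have -> : << coeff k v *g k >> = coeff k v *: << k >> :> V.
    by apply/eqP/freeg_eqP => l; rewrite coeffZ !coeffU mul1r.
  rewrite !linearZ; apply: (submoduleZ (closure_submodule X)).
  by apply: closure_gen; exists i, k.
have [G [j [flG piG purj ranj]]] := closure_module X flW piW.
have PP : emb (K -> K -> bool) (K -> bool).
  apply: emb_trans (@emb_curry _ _ _) _; apply: emb_arrow_dom true _; exact: emb_square.
have embIV : emb I (set V).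
  exists (@projT1 _ _) => -[S [sS fS]] [S' [sS' fS']] /= SS'; case: _ / SS' sS' fS' => sS' fS'.
  have E : sS = sS' by exact: Prop_irrelevance.
  by case: _ / E fS' => fS'; rewrite (Prop_irrelevance fS fS').
have embVK : emb V K.
  apply: (@emb_trans _ (seq (R * K))).
    exists (fun v => [seq (coeff k v, k) | k <- dom v]) => v w E.
    by rewrite -(Freeg_dom v) E Freeg_dom.
  by apply: (emb_seqK natK); apply: (emb_prodK natK); [exists inl => x y []|exact: emb_refl].
have embI : emb I (K -> bool).
  apply: emb_trans embIV _; apply: (@emb_trans _ (V -> bool)).
    exists (fun S v => `[< S v >]) => S S' SS'; apply/funext => v.
    by apply/propext; split=> /asboolT; [rewrite (congr1 (@^~ v) SS')|rewrite -(congr1 (@^~ v) SS')] => /asboolP.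
  exact: emb_arrow_dom true embVK.
have embK : emb K (K -> bool) by exact/emb_power_self/emb_refl.
have PB := emb_power_prod natK PP.
have coverX : covers (K -> bool) X.
  apply: (@covers_emb (I * K)); first exact: 0.
    by apply: emb_trans (emb_prod embI embK) PB.
  by exists (fun p => gen_at p.1 p.2) => _ [i [k ->]]; exists (i, k).
have [injj _] := purj.
have container (F : lmodType R) : flat F -> emb F K ->
    exists f : {linear F -> G}, pure_embedding f.
  move=> flF [e ei]; have [d de] := emb_left_inverse 0 ei.
  pose phi : V -> F := fglift (d : Kc -> F).
  have phiB : zmod_morphism phi by exact: lift_is_additive.
  have phiE v : phi v = \sum_(k <- dom v) coeff k v *: d k.
    by rewrite -{1}(freeg_sumE v) zmod_morphism_sum //; apply: eq_bigr => k _; exact: liftU.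
  have phiZ a v : phi (a *: v) = a *: phi v.
    rewrite [in RHS]phiE -{1}(freeg_sumE v) !scaler_sumr zmod_morphism_sum //.
    apply: eq_bigr => k _.
    have -> : a *: << coeff k v *g k >> = << a * coeff k v *g k >> :> V.
      by apply/eqP/freeg_eqP => l; rewrite coeffZ !coeffU mulrA.
    by rewrite scalerA; exact: liftU.
  have lin_phi : linear phi.
    by move=> a u v; rewrite -[v in LHS]opprK phiB phiZ -[- v]sub0r phiB -(subrr 0) phiB subrr sub0r opprK.
  have phi0 : phi 0 = 0 by exact: (linear0 (linear_pack lin_phi)).
  pose S := [set v | phi v = 0].
  have sS : submodule S.
    apply/submoduleP; split; first exact: phi0.
    by move=> a u v Su Sv; rewrite /S /= lin_phi Su Sv scaler0 addr0.
  have phi_surj x : exists v, phi v = x.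
    by exists << e x >>; rewrite /phi liftU scale1r de.
  pose q : {linear V -> quotmod sS} := quot_proj sS.
  have [|y [v [/= /esym v0 ->]]|x|psi psiP] := @linear_of_graph R F (quotmod sS)
    [set p | exists v, p.1 = phi v /\ p.2 = q v].
  - apply/submoduleP; split; first by exists 0; split; rewrite ?phi0 ?linear0.
    move=> a p p' [v [p1 p2]] [v' [p1' p2']]; exists (a *: v + v').
    by rewrite lin_phi linearP -p1 -p2 -p1' -p2'.
  - exact/quot_proj_eq0.
  - by have [v <-] := phi_surj x; exists (q v), v.
  have [|y [v [/= /esym v0 ->]]|x|psi' psi'P] := @linear_of_graph R (quotmod sS) F
    [set p | exists v, p.1 = q v /\ p.2 = phi v].
  - apply/submoduleP; split; first by exists 0; split; rewrite ?phi0 ?linear0.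
    move=> a p p' [v [p1 p2]] [v' [p1' p2']]; exists (a *: v + v').
    by rewrite lin_phi linearP -p1 -p2 -p1' -p2'.
  - by move/quot_proj_eq0: v0.
  - by have [v <-] := quot_proj_surj x; exists (phi v), v.
  have psiK : cancel psi psi'.
    move=> x; have [v [/= xv ->]] := psiP x; have [w [/= /quot_proj_eq vw ->]] := psi'P (q v).
    by apply/eqP; rewrite xv eq_sym -subr_eq0 -phiB; apply/eqP.
  have psi'K : cancel psi' psi.
    move=> x; have [v [/= xv ->]] := psi'P x; have [w [/= vw ->]] := psiP (phi v).
    rewrite xv; apply/quot_proj_eq; rewrite /S /= phiB vw; exact: subrr.
  have flQ : flat (quotmod sS) by exact: flat_pure (pure_embedding_retract psi'K) flF.
  pose i : I := existT _ S (exist _ sS flQ).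
  have pur_i : pure_embedding (th \o (inc i \o psi)).
    have pur_inc : pure_embedding (inc i) by exact: pure_embedding_retract (prj_inc i).
    exact: pure_embedding_comp (pure_embedding_comp (pure_embedding_retract psiK) pur_inc) purth.
  have [|f fE] := @linear_lift _ _ _ _ (th \o (inc i \o psi) : {linear F -> W}) j injj.
    by move=> x; rewrite ranj; exact: cl_inc.
  exists f; apply: (pure_embedding_factor (g := j)).
  apply/pure_embeddingP => m k A v _ sv; apply: pure_embedding_reflects pur_i _.
  by apply: soluble_ext sv => l; exact: fE.
exists G; split=> //.
- have [g gi] := covers_subtype (closure_covers PP (emb_refl _) coverX).
  have clj x : sol_closure X (j x) by rewrite -ranj; exists x.
  by exists (fun x => g (exist _ (j x) (clj x))) => x y /gi[]; exact: injj.
- have [|f [injf _]] := container _ (@flat_regular R); first by exists inl => x y [].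
  exists (f 1) => f0; have := oner_neq0 R; rewrite -(inj_eq injf) linear0 f0; exact/negP/negPn.
Qed.

End Universal.

(** * Universal flat modules *)

Section UniversalModule.
Variable R : nzRingType.
Local Notation K := (R + nat)%type.

Variables (L : Type) (lt : L -> L -> Prop).
Hypotheses (lt_trans : forall a b c, lt a b -> lt b c -> lt a c)
  (lt_total : forall a b, [\/ lt a b, a = b | lt b a])
  (lt_min : forall S : set L, S !=set0 -> exists2 a, S a & forall b, S b -> ~ lt b a).

(** Here [Z] is to be the direct sum of copies of [G] indexed by [L], which is
    pure in [W] by [th]. *)
Variables (G : lmodType R) (Z W : lmodType R).
Hypotheses (piG : pure_injective G) (container : forall F : lmodType R,
  flat F -> emb F K -> exists f : {linear F -> G}, pure_embedding f).
Variables (inc : L -> {linear G -> Z}) (prj : L -> {linear Z -> G}) (th : {linear Z -> W}).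
Hypotheses (prj_inc : forall a x, prj a (inc a x) = x)
  (prj_off : forall a b x, a <> b -> prj b (inc a x) = 0).
Hypotheses (piW : pure_injective W) (purth : pure_embedding th).

Definition copies (a : L) : set W :=
  [set w | exists b g, (b = a \/ lt b a) /\ w = th (inc b g)].

Definition stage (a : L) : set W := sol_closure (copies a).

Lemma stage_mono a b : lt a b -> stage a `<=` stage b.
Proof.
move=> ab; apply: closure_mono => _ [c [g [ca ->]]]; exists c, g; split=> //.
by right; case: ca => [->//|ca]; exact: lt_trans ab.
Qed.

Lemma copy_stage a g : stage a (th (inc a g)).
Proof. by apply: closure_gen; exists a, g; split=> //; left. Qed.

Variables (N : lmodType R) (nu : L -> N).
Hypotheses (flN : flat N) (nu_onto : forall n, exists a, nu a = n).

(** A partial pure embedding with graph [Gam], which takes its values in the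
    stages with index in the initial segment [A]. The last condition says both
    that it is pure and that its image is independent of the copies of [G] with
    other indices. *)
Definition partial_embedding (A : set L) (Gam : set (N * W)) : Prop :=
  [/\ [/\ forall a b, A a -> lt b a -> A b,
          forall a, A a -> exists w, Gam (nu a, w) &
          forall n w, Gam (n, w) -> w = 0 \/ exists2 a, A a & stage a w],
      submodule Gam, forall w, Gam (0, w) -> w = 0,
      forall m k (B : 'M[R]_(m, k)) n w, (forall i, Gam (n i, w i)) -> soluble B n ->
        exists y u, (forall j, Gam (y j, u j)) /\ forall i, \sum_j B i j *: y j = n i &
      forall m k (B : 'M[R]_(m, k)) n w z, (forall i, Gam (n i, w i)) ->
        (forall a i, A a -> prj a (z i) = 0) ->
        soluble B (fun i => w i + th (z i)) -> soluble B n /\ soluble B z].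

(** The elements of [N] to be added are those of a small pure submodule modulo
    the domain. The partial embedding takes its values in the stage of [a], and
    by pure-injectivity of this stage extends to a homomorphism [h0] to it. Its
    component in the copy with index [a], measured by a projection [pi] which
    exists by independence, is replaced by an embedding of the small quotient
    in this copy. *)
Lemma partial_embedding_step (A : set L) (Gam : set (N * W)) (a : L) :
    partial_embedding A Gam -> ~ A a -> (forall b, lt b a -> A b) ->
  exists Gam', Gam `<=` Gam' /\ partial_embedding (A `|` [set a]) Gam'.
Proof.
move=> [[Aini Adom Aval] sG G0 Gpure Gind] nAa Aa.
have Alt b : A b -> lt b a.
  move=> Ab; have [//|ba|/(Aini _ _ Ab)//] := lt_total b a.
  by case: nAa; rewrite -ba.
pose N' := [set n | exists w, Gam (n, w)].
have sN' : submodule N'.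
  apply/submoduleP; split; first by exists 0; exact: submodule0 sG.
  move=> c n n' [w Gw] [w' Gw']; exists (c *: w + w').
  exact (submoduleD sG (submoduleZ sG c Gw) Gw').
have pureN' : pure_in N'.
  move=> m k B n /choice[w Gw] /(Gpure _ _ _ _ _ Gw)[y [u [Gy yn]]].
  by exists y => // j; exists (u j).
pose q : {linear N -> quotmod sN'} := quot_proj sN'.
have q0 n : q n = 0 <-> N' n by exact: quot_proj_eq0.
have q_onto u : exists n, q n = u by exact: quot_proj_surj.
have flQ : flat (quotmod sN') by exact: flat_quotient q_onto q0 pureN' flN.
have [P [sP pureP Pa coverP]] := small_pure_submodule (q (nu a)).
have [F [phi [injphi ranphi]]] := submod_exists sP.
have purphi : pure_embedding phi by apply: pure_in_embedding; rewrite ?ranphi.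
have [|f purf] := container (flat_pure purphi flQ).
  have [e ei] := covers_subtype coverP.
  have Pphi x : P (phi x) by rewrite -ranphi; exists x.
  by exists (fun x => e (exist _ (phi x) (Pphi x))) => x y /ei[]; exact: injphi.
pose N'' := [set n | P (q n)].
have /choice[r rE] : forall n, exists x, N'' n -> phi x = q n.
  move=> n; have [Nn|nNn] := pselect (N'' n); last by exists 0.
  by move: Nn; rewrite /N'' /= -ranphi => -[x _ <-]; exists x.
pose rho n := f (r n).
have rhoP c n n' : N'' n -> N'' n' -> rho (c *: n + n') = c *: rho n + rho n'.
  move=> Nn Nn'; rewrite /rho -linearP; congr (f _); apply: injphi.
  rewrite linearP !rE // ?linearP //.
  by rewrite /N'' /= linearP; exact: (submoduleD sP (submoduleZ sP c Nn) Nn').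
have rho0 n : N' n -> rho n = 0.
  move=> N'n; have qn : q n = 0 by exact/q0.
  rewrite /rho -[RHS](linear0 f); congr (f _); apply: injphi; rewrite linear0 rE //.
  by rewrite /N'' /= qn; exact: submodule0.
have [||h0 [h0E h0G]] := @closure_extends R W piW (copies a) N Gam.
- split=> // m k B n w Gnw /(Gpure _ _ _ _ _ Gnw)[y [u [Gyu yn]]]; exists u => i.
  apply/eqP; rewrite -subr_eq0; apply/eqP/G0.
  have Gsum : Gam (\sum_j B i j *: y j, \sum_j B i j *: u j).
    have := submodule_comb sG (index_enum 'I_k) (B i) Gyu; congr Gam.
    by rewrite [LHS]surjective_pairing (raddf_sum fst) (raddf_sum snd).
  have := submoduleB sG Gsum (Gnw i); congr Gam; congr pair => /=.
  by rewrite yn subrr.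
- move=> n w /Aval[->|[b Ab]]; first exact: closure0.
  exact: stage_mono (Alt _ Ab) _.
have [|pi piE] := @pure_injective_extends R W G
    [set p | exists n w z, [/\ Gam (n, w), forall b, A b -> prj b z = 0 & p = (w + th z, prj a z)]] piG.
  split.
    apply/submoduleP; split.
      exists 0, 0, 0; split; [exact: submodule0 sG|by move=> b _; rewrite linear0|].
      by rewrite !linear0 addr0.
    move=> c _ _ [n [w [z [Gw zA ->]]]] [n' [w' [z' [Gw' zA' ->]]]].
    exists (c *: n + n'), (c *: w + w'), (c *: z + z'); split.
    - exact (submoduleD sG (submoduleZ sG c Gw) Gw').
    - by move=> b Ab; rewrite linearP zA // zA' // scaler0 addr0.
    - by congr pair; rewrite /= !linearP // scalerDr addrACA.
  move=> m k B v g /choice[n /choice[w /choice[z vgE]]] sv.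
  have [|||_ sz] := Gind m k B n w z.
  - by move=> i; case: (vgE i).
  - by move=> b i Ab; case: (vgE i) => _ + _; apply.
  - by apply: soluble_ext sv => i; case: (vgE i) => _ _ [].
  by apply: soluble_ext (soluble_map (prj a) sz) => i; case: (vgE i) => _ _ [].
have piGam n w : Gam (n, w) -> pi w = 0.
  move=> Gnw; apply: piE; exists n, w, 0; split=> //.
    by move=> b _; rewrite linear0.
  by rewrite !linear0 addr0.
have piZ z : (forall b, A b -> prj b z = 0) -> pi (th z) = prj a z.
  move=> zA; apply: piE; exists 0, 0, z; split=> //; first exact: submodule0 sG.
  by rewrite add0r.
have piI g : pi (th (inc a g)) = g.
  rewrite piZ ?prj_inc // => b Ab; apply: prj_off => ab.
  by apply: nAa; rewrite ab.
pose h n := h0 n - th (inc a (pi (h0 n))).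
have hP c n n' : h (c *: n + n') = c *: h n + h n'.
  by rewrite /h !linearP /= scalerBr scalerN addrACA.
have pih n : pi (h n) = 0 by rewrite /h linearB /= piI subrr.
have hGam n w : Gam (n, w) -> h n = w.
  by move=> Gnw; rewrite /h (h0G _ _ Gnw) (piGam _ _ Gnw) !linear0 addr0.
pose h' n := h n + th (inc a (rho n)).
have h'P c n n' : N'' n -> N'' n' -> h' (c *: n + n') = c *: h' n + h' n'.
  by move=> Nn Nn'; rewrite /h' hP rhoP // !linearP /= [in RHS]scalerDr addrACA.
have h'Gam n w : Gam (n, w) -> h' n = w.
  by move=> Gnw; rewrite /h' (hGam _ _ Gnw) rho0 ?linear0 ?addr0 //; exists w.
have sN'' : submodule N''.
  apply/submoduleP; split; first by rewrite /N'' /= linear0; exact: submodule0.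
  by move=> c n n' Nn Nn'; rewrite /N'' /= linearP; exact: (submoduleD sP (submoduleZ sP c Nn) Nn').
have N'N'' n : N' n -> N'' n.
  by move=> /q0 qn; rewrite /N'' /= qn; exact: submodule0.
have h'sum k (b : 'I_k -> R) (y : 'I_k -> N) : (forall j, N'' (y j)) ->
    h' (\sum_j b j *: y j) = \sum_j b j *: h' (y j).
  move=> Ny; elim: (index_enum _) => [|j s IH].
    by rewrite !big_nil; apply: h'Gam; exact: submodule0 sG.
  by rewrite !big_cons h'P // ?IH //; exact: submodule_comb.
pose Gam' := [set p : N * W | N'' p.1 /\ p.2 = h' p.1].
exists Gam'; split.
  move=> [n w] Gnw; split => /=; first by apply: N'N''; exists w.
  by rewrite (h'Gam _ _ Gnw).
split.
- split.
  + move=> c b [Ac|->] lt_bc; left; [exact: Aini Ac lt_bc|exact: Aa].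
  + move=> b [/Adom[w Gw]|->]; last by exists (h' (nu a)).
    by exists w; split; [apply: N'N''; exists w|rewrite /= (h'Gam _ _ Gw)].
  + move=> n w [Nn /= ->]; right; exists a; first by right.
    have sE : submodule (stage a) by exact: closure_submodule.
    apply: (submoduleD sE); last exact: copy_stage.
    apply: (submoduleB sE); last exact: copy_stage.
    exact: h0E.
- apply/submoduleP; split.
    split; [exact: submodule0 sN''|]; apply/esym/h'Gam; exact: submodule0 sG.
  move=> c p p' [Np ph] [Np' ph']; split.
    exact: (submoduleD sN'' (submoduleZ sN'' c Np) Np').
  by rewrite -[LHS]/(c *: p.2 + p'.2) ph ph' -h'P.
- by move=> w [_ /= ->]; apply: h'Gam; exact: submodule0 sG.
- move=> m k B n w Gnw sn.
  have [||y Py yn] := pureP m k B (fun i => q (n i)).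
  + by move=> i; case: (Gnw i).
  + exact: soluble_map.
  have /choice[u uy] : forall j, exists u, q u = y j by move=> j; exact: q_onto.
  have N'd i : N' (n i - \sum_j B i j *: u j).
    apply/q0; apply/eqP; rewrite linearB subr_eq0 -yn linear_sum; apply/eqP.
    by apply: eq_bigr => j _; rewrite linearZ /= uy.
  have [x N'x xd] := pureN' _ _ _ _ N'd (solubleB sn (soluble_comb B u)).
  exists (fun j => u j + x j), (fun j => h' (u j + x j)); split=> [j|i].
    split=> //; apply: (submoduleD sN''); last exact: N'N''.
    by rewrite /N'' /= uy.
  under eq_bigr do rewrite scalerDr.
  by rewrite big_split /= xd addrC subrK.
- move=> m k B n w z Gnw zA sv.
  have Nn i : N'' (n i) by case: (Gnw i).
  have wE i : w i = h' (n i) by case: (Gnw i).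
  have sv' : soluble B (fun i => h' (n i) + th (z i)) by apply: soluble_ext sv => i; rewrite wE.
  have srho : soluble B (fun i => rho (n i)).
    apply: soluble_ext (soluble_map pi sv') => i.
    rewrite linearD /h' linearD pih add0r piI piZ ?zA ?addr0 //; first by right.
    by move=> b Ab; apply: zA; left.
  have [y yr] := pure_embedding_reflects purf srho.
  have /choice[u uy] : forall j, exists u, q u = phi (y j) by move=> j; exact: q_onto.
  have Nu j : N'' (u j) by rewrite /N'' /= uy -ranphi; exists (y j).
  have N'd i : N' (n i - \sum_j B i j *: u j).
    apply/q0; apply/eqP; rewrite linearB subr_eq0 -rE // -yr !linear_sum; apply/eqP.
    by apply: eq_bigr => j _; rewrite !linearZ /= uy.
  have [d dG] := choice N'd.
  have dE i : d i = h' (n i) - \sum_j B i j *: h' (u j).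
    rewrite -(h'Gam _ _ (dG i)) addrC -scaleN1r h'P ?h'sum ?scaleN1r 1?addrC //.
    exact: submodule_comb.
  have [||sd sz] := Gind m k B _ d z dG.
  + by move=> b i Ab; apply: zA; left.
  + apply: soluble_ext (solubleB sv' (soluble_comb B (fun j => h' (u j)))) => i.
    by rewrite dE addrAC.
  split=> //; apply: soluble_ext (solubleD sd (soluble_comb B u)) => i.
  by rewrite subrK.
Qed.

Lemma partial_embedding_total : exists Gam, partial_embedding setT Gam.
Proof.
pose ind (S : set (L + N * W)) : set L := [set a | S (inl a)].
pose gra (S : set (L + N * W)) : set (N * W) := [set p | S (inr p)].
pose P := [set S : set (L + N * W) | partial_embedding (ind S) (gra S)].
have [||S [_ PS maxS]] := @Zorn_above _ P (inr @` [set 0]).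
- have gra0 p : gra (inr @` [set 0]) p -> p = 0 by move=> [_ -> [<-]].
  have gra00 : gra (inr @` [set 0]) 0 by exists 0.
  have ind0 b : ~ ind (inr @` [set 0]) b by move=> [].
  split.
  + by split=> [b c /ind0|b /ind0|n w /gra0[_ ->]] //; left.
  + apply/submoduleP; split=> // c u v /gra0 -> /gra0 ->.
    by rewrite scaler0 addr0.
  + by move=> w /gra0[].
  + move=> m k B n w nw _; exists (fun=> 0), (fun=> 0); split=> // i.
    rewrite big1 => [|j _]; last exact: scaler0.
    by have [-> _] := gra0 _ (nw i).
  + move=> m k B n w z nw _ sv; split.
      exists (fun=> 0) => i; rewrite big1 => [|j _]; last exact: scaler0.
      by have [-> _] := gra0 _ (nw i).
    apply: pure_embedding_reflects purth _; apply: soluble_ext sv => i.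
    by have [_ ->] := gra0 _ (nw i); rewrite add0r.
- move=> F F0 FP totF.
  have tup m (n : 'I_m -> N) w : (forall i, gra (\bigcup_(S in F) S) (n i, w i)) ->
      exists2 S, F S & forall i, gra S (n i, w i).
    by move=> nw; exact: (chain_tuple (v := fun i => inr (n i, w i)) F0 totF).
  split.
  + split.
    * by move=> b c [S FS Sb] cb; exists S => //; have [[Aini _ _] _ _ _ _] := FP _ FS; exact: Aini Sb cb.
    * by move=> b [S FS Sb]; have [[_ /(_ b Sb)[w Sw] _] _ _ _ _] := FP _ FS; exists w, S.
    * move=> n w [S FS Snw]; have [[_ _ /(_ n w Snw)[->|[b Sb bw]]] _ _ _ _] := FP _ FS; first by left.
      by right; exists b => //; exists S.
  + have -> : gra (\bigcup_(S in F) S) = \bigcup_(T in [set gra S | S in F]) T.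
      apply/seteqP; split=> p; first by move=> [S FS Sp]; exists (gra S) => //; exists S.
      by move=> [_ [S FS <-] Sp]; exists S.
    apply: chain_submodule.
    * by have [S FS] := F0; exists (gra S), S.
    * move=> _ _ [S FS <-] [T FT <-].
      by have [ST|TS] := totF _ _ FS FT; [left|right] => p; [exact: ST|exact: TS].
    * by move=> _ [S FS <-]; have [_ + _ _ _] := FP _ FS.
  + by move=> w [S FS Sw]; have [_ _ G0 _ _] := FP _ FS; exact: G0.
  + move=> m k B n w /tup[S FS nw] sn; have [_ _ _ Gpure _] := FP _ FS.
    have [y [u [Sy yn]]] := Gpure _ _ _ _ _ nw sn.
    by exists y, u; split=> // j; exists S => //; exact: Sy.
  + move=> m k B n w z /tup[S FS nw] zA; have [_ _ _ _ Gind] := FP _ FS.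
    by apply: Gind nw _ => b i Sb; apply: zA; exists S.
have [full|notfull] := pselect (forall a, ind S a).
  exists (gra S); suff <- : ind S = setT by [].
  by apply/seteqP; split.
have [|a nSa amin] := lt_min (S := [set a | ~ ind S a]); first exact/existsNP.
exfalso; have [|Gam [SGam PGam]] := partial_embedding_step PS nSa.
  by move=> b ba; apply: contrapT => /amin; apply.
pose T : set (L + N * W) := [set x | match x with inl b => (ind S `|` [set a]) b | inr p => Gam p end].
apply: nSa; apply: (maxS T) => //; last by right.
by move=> [b|p] Sx; [left|exact: SGam].
Qed.

Lemma stages_universal : exists f : {linear N -> W}, pure_embedding f /\
  forall n, f n = 0 \/ exists a, stage a (f n).
Proof.
have [Gam [[_ Gnu Gval] sG G0 _ Gind]] := partial_embedding_total.
have [|f fG] := linear_of_graph sG G0.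
  by move=> n; have [a <-] := nu_onto n; exact: Gnu.
exists f; split; last by move=> n; have [->|[a _ an]] := Gval _ _ (fG n); [left|right; exists a].
apply/pure_embeddingP => m k A v _ sv.
have [||//] := Gind m k A v (fun i => f (v i)) (fun=> 0) (fun i => fG (v i)).
  by move=> a i _; rewrite linear0.
by apply: soluble_ext sv => i; rewrite linear0 addr0.
Qed.

End UniversalModule.

(** The union of the stages has at most [lam * lam = lam] elements by
    [segment_bound], and at least [lam], one for each copy of [G]. *)
Lemma universal_model_exists (R : nzRingType)
    (envelope_flat : forall (M E : lmodType R) (i : {linear M -> E}),
      flat M -> pure_injective_envelope i -> flat E) (lam : Type) :
    emb nat lam ->
    emb (R + nat -> lam) lam \/
      (forall mu, ~ emb lam mu -> ~ emb lam (R + nat -> mu)) ->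
  exists U : lmodType R, universal_model lam U.
Proof.
move=> natL powL; have natK := emb_nat_sum R.
have [lt [lt_trans lt_total lt_min lt_small]] := initial_well_order lam.
have [G [flG piG smallG [g0 g0N] container]] := small_flat_container envelope_flat.
have [Z [inc [prj [prj_inc prj_off gen]]]] := direct_sum_exists (fun _ : lam => G).
have flZ : flat Z by exact: flat_direct_sum gen _.
have [W [th [flW piW purth]]] := flat_pure_injective_extension envelope_flat flZ.
pose E := stage lt inc th.
have [l0] := emb_inhabited natL.
have subE a : submodule (E a) by exact: closure_submodule.
have monoE a b : lt a b -> E a `<=` E b by exact: stage_mono.
have chainE a b : E a `<=` E b \/ E b `<=` E a.
  have [/monoE|->|/monoE] := lt_total a b; by [left|right].
pose U := \bigcup_(S in range E) S.
have E0 : range E !=set0 by exists (E l0), l0.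
have totE : total_on (range E) subset.
  by move=> _ _ [a _ <-] [b _ <-]; exact: chainE.
have subU : submodule U by apply: chain_submodule => // _ [a _ <-].
have pureU : pure_in U.
  move=> m k A v /(chain_tuple E0 totE)[_ [a _ <-] av] sv.
  have [y ya yv] := closure_pure piW av sv.
  by exists y => // j; exists (E a).
have [M [j [injj ranj]]] := submod_exists subU.
have purj : pure_embedding j by apply: pure_in_embedding; rewrite ?ranj.
exists M; split.
- exact: flat_pure purj flW.
- rewrite /has_card card_eq_le; apply/andP; split; apply/card_leP_emb.
    have EL a : emb {w | E a w} lam.
      have [B [KB PB SB BL]] := segment_bound natK natL powL (@lt_small a).
      have KB1 := emb_power_self PB.
      have natB := emb_trans natK KB1.
      apply: emb_trans BL; apply: covers_subtype; apply: closure_covers => //.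
      apply: (@covers_emb (option {b | lt b a} * G)); first exact: 0.
        apply: emb_prodK => //; last exact: emb_trans smallG PB.
        exact: emb_optionK.
      exists (fun p => th (inc (if p.1 is Some b then sval b else a) p.2)).
      move=> _ [b [g [[->|ba] ->]]]; first by exists (None, g).
      by exists (Some (exist _ b ba), g).
    apply: emb_trans (emb_square natL).
    have /choice[c cP] : forall a, exists f : W -> lam, forall w w', E a w -> E a w' -> f w = f w' -> w = w'.
      move=> a; have [f fi] := EL a.
      exists (fun w => if pselect (E a w) is left aw then f (exist _ w aw) else l0) => w w' aw aw'.
      case: pselect => // aw1; case: pselect => // aw1' /fi E1; exact: (congr1 sval E1).
    have /choice[st stE] : forall x : M, exists a, E a (j x).
      move=> x; have : U (j x) by rewrite -ranj; exists x.
      by move=> [_ [a _ <-] ax]; exists a.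
    exists (fun x => (st x, c (st x) (j x))) => x y [sxy cxy].
    by apply: injj; apply: (cP (st x)) => //; rewrite ?sxy // -{1}sxy.
  have /choice[u uE] : forall a, exists x, j x = th (inc a g0).
    move=> a; have : U (th (inc a g0)) by exists (E a) => //; exact: copy_stage.
    by rewrite -ranj => -[x _ <-]; exists x.
  exists u => a b uab; apply: contrapT => ab; apply: g0N.
  rewrite -(prj_inc a g0) -(prj_off b a g0) => [|ba]; last by apply: ab.
  by congr (prj a _); apply: purth.1; rewrite -!uE uab.
- move=> N flN cardN.
  have LN : emb lam N by apply/card_leP_emb; have /card_eqPle[] := cardN.
  have NL : emb N lam by apply/card_leP_emb; have /card_eqPle[] := cardN.
  have [e ei] := NL; have [nu nuE] := emb_left_inverse 0 ei.
  have [|f [purf fE]] := stages_universal lt_trans lt_total lt_min piG container prj_inc prj_off piW purth flN (nu := nu).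
    by move=> n; exists (e n).
  have [|f' f'E] := @linear_lift _ _ _ _ f j injj.
    move=> n; rewrite ranj; have [->|[a an]] := fE n; last by exists (E a).
    exact: submodule0.
  exists f'; apply: (pure_embedding_factor (g := j)).
  apply/pure_embeddingP => m k A v _ sv; apply: pure_embedding_reflects purf _.
  by apply: soluble_ext sv => i; exact: f'E.
Qed.

Theorem lemma4p6 (R : nzRingType)
    (envelope_flat : forall (M E : lmodType R) (i : {linear M -> E}),
      flat M -> pure_injective_envelope i -> flat E)
    (lam : cardinal) (lam_infinite : infinite_set [set: lam]) :
  ([set: R + nat -> lam] #= [set: lam] -> stable R lam) /\
  (([set: R + nat -> lam] #= [set: lam] \/
    forall mu : cardinal, card_lt mu lam -> card_lt (R + nat -> mu) lam) ->
   exists U : lmodType R, universal_model lam U).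
Proof.
have natL : emb nat lam by apply/card_leP_emb; exact/infiniteP.
have powE : [set: R + nat -> lam] #= [set: lam] -> emb (R + nat -> lam) lam.
  by move=> /card_eqPle[KL _]; exact/card_leP_emb.
split=> [/powE|powL]; first exact: stable_of_power.
apply: universal_model_exists => //.
case: powL => [/powE|powL]; [by left|right] => mu Lmu.
have [|_ /negP nle] := andP (powL mu _); last by move=> /card_leP_emb.
apply/andP; split; last by apply/negP => /card_leP_emb.
by apply/card_leP_emb; have [//|/Lmu] := emb_total mu lam.
Qed.
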